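(* Let $\omega\in\mathcal{W}_0$ be given with $\gamma(\omega)>1$. Then for any $\gamma>0$ satisfying $0<\gamma<\gamma(\omega)-1$ the Borel map $\mathcal{B}:\mathcal{A}_{(\omega)}(S_{\gamma})\longrightarrow\Lambda^1_{(\omega)}$ is surjective.
   Context: $\mathbb{N}=\{0,1,2,\dots\}$. A weight function is a continuous nondecreasing function $\omega:[0,+\infty)\to[0,+\infty)$ with $\omega(0)=0$ and $\lim_{t\to+\infty}\omega(t)=+\infty$. $\mathcal{W}_0$ is the set of weight functions $\omega$ such that: $\omega(t)=0$ for all $t\in[0,1]$; $\log(t)=o(\omega(t))$ as $t\to+\infty$; and $\varphi_\omega:t\mapsto\omega(e^t)$ is convex on $\mathbb{R}$. For $\omega\in\mathcal{W}_0$ put $\varphi^{*}_{\omega}(x):=\sup\{xy-\varphi_{\omega}(y):y\ge 0\}$, $x\ge 0$. Growth index: $\gamma(\omega):=\sup\{\gamma>0:\ \exists K>1:\ \limsup_{t\to+\infty}\frac{\omega(K^{\gamma}t)}{\omega(t)}<K\}\in[0,+\infty]$ (equal to $0$ if the set is empty). Sectors: $\mathcal{R}$ is the Riemann surface of the logarithm and, for $\gamma>0$, $S_\gamma:=\{z\in\mathcal{R}:|\arg(z)|<\gamma\pi/2\}$. $\mathcal{H}(S)$ is the space of holomorphic functions on $S$. Spaces (Beurling type): for $l>0$, $\mathcal{A}_{\omega,l}(S):=\{f\in\mathcal{H}(S):\sup_{z\in S,p\in\mathbb{N}}\frac{|f^{(p)}(z)|}{\exp(\frac1l\varphi^{*}_{\omega}(lp))}<+\infty\}$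 and $\Lambda^1_{\omega,l}:=\{(a_p)_p\in\mathbb{C}^{\mathbb{N}}:\sup_{p\in\mathbb{N}}\frac{|a_p|}{\exp(\frac1l\varphi^{*}_{\omega}(lp))}<+\infty\}$; $\mathcal{A}_{(\omega)}(S):=\bigcap_{l>0}\mathcal{A}_{\omega,l}(S)$, $\Lambda^1_{(\omega)}:=\bigcap_{l>0}\Lambda^1_{\omega,l}$. Borel map: $\mathcal{B}(f):=(f^{(p)}(0))_{p\in\mathbb{N}}$, where $f^{(p)}(0):=\lim_{z\in S,\,z\to 0}f^{(p)}(z)$. *)

(* Defs.v *)
From HB Require Import structures.
From mathcomp Require Import all_boot all_order all_algebra.
From mathcomp Require Import all_classical all_reals all_analysis.
From mathcomp Require Import complex.

Set Implicit Arguments.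
Unset Strict Implicit.
Unset Printing Implicit Defensive.

Import Order.TTheory GRing.Theory Num.Theory.
Import numFieldNormedType.Exports.

Local Open Scope classical_set_scope.
Local Open Scope complex_scope.
Local Open Scope ring_scope.

(* The topology of the modulus on R[i], inherited from its regular module; the
   library provides it for abstract numClosedFieldTypes only. *)
HB.instance Definition _ (R : rcfType) := NormedModule.copy R[i] R[i]^o.

Section WeightFunctions.
Context {R : realType}.
Implicit Types (omega : R -> R) (x l gamma : R).

(* Functions on [0, +oo[ are represented by total functions R -> R; their values
   at negative arguments play no role in any definition below. *)
Definition weight_function omega : Prop :=
  [/\ {within `[0, +oo[, continuous omega},
      {in `[0, +oo[ &, nondecreasing omega},
      forall t, 0 <= t -> 0 <= omega t,
      omega 0 = 0 &
      omega t @[t --> +oo] --> +oo].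

Definition phi omega : R -> R := fun t => omega (expR t).

Definition W0 : set (R -> R) := [set omega |
  [/\ weight_function omega,
      forall t, 0 <= t <= 1 -> omega t = 0,
      (@ln R : R -> R^o) =o_ (FilterType (pinfty_nbhs R) _) (omega : R -> R^o) &
      convex_function (setT : set R) (phi omega)]].

(* For omega in W0 this supremum is finite: the set contains - phi omega 0 = 0
   and is bounded above since ln t = o(omega t). *)
Definition phi_star omega x : R :=
  sup [set x * y - phi omega y | y in [set y | 0 <= y]].

(* The element 0 is inserted because the index is 0, not -oo, when no gamma
   qualifies. *)
Definition growth_index omega : \bar R :=
  ereal_sup (0%E |` [set gamma%:E | gamma in [set gamma | 0 < gamma /\
    exists2 K : R, 1 < K &
      (limf_esup (fun t => (omega (K `^ gamma * t) / omega t)%:E)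
         (+oo%R : set_system R) < K%:E)%E]]).

Definition weight_seq omega l (p : nat) : R :=
  expR (l^-1 * phi_star omega (l * p%:R)).

End WeightFunctions.

(* The Riemann surface of the logarithm in polar coordinates: the pair (r, t)
   with r > 0 is the point of modulus r and argument t, with no identification
   modulo 2 pi. *)
Section LogSurface.
Context {R : realType}.
Implicit Types (z w : R * R) (f : R * R -> R[i]) (S : set (R * R)).

Definition modulus z : R := z.1.
Definition argument z : R := z.2.

Definition log_surface : set (R * R) := [set z | 0 < modulus z].

(* The covering map onto the punctured plane; it is the local coordinate that
   defines the complex structure of the surface. *)
Definition covering z : R[i] :=
  (modulus z * cos (argument z)) +i* (modulus z * sin (argument z)).

Definition sector (gamma : R) : set (R * R) :=
  [set z | log_surface z /\ `|argument z| < gamma * pi / 2].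

(* Near a point z of log_surface, covering is injective, so that the denominator
   does not vanish on a punctured neighbourhood of z. *)
Definition diff_quotient f z w : R[i] := (f w - f z) / (covering w - covering z).

Definition holomorphic S f : Prop :=
  forall z, S z -> cvg (diff_quotient f z w @[w --> z^']).

Definition cderive f : R * R -> R[i] :=
  fun z => lim (diff_quotient f z w @[w --> z^']).

Definition cderiven (p : nat) f : R * R -> R[i] := iter p cderive f.

(* The filter "z tends to 0 within S". *)
Definition vertex S : set_system (R * R) :=
  filter_from [set e : R | 0 < e] (fun e => [set z | S z /\ modulus z < e]).

(* For f in the ultraholomorphic classes below and S a sector, all the limits
   exist, each derivative being bounded on S. *)
Definition Borel S f : nat -> R[i] :=
  fun p => lim (cderiven p f z @[z --> vertex S]).

End LogSurface.

Section Spaces.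
Context {R : realType}.
Implicit Types (omega : R -> R) (l : R) (S : set (R * R)).

(* Members are total functions on R * R; only their restriction to the open
   set S matters. *)
Definition ultraholomorphic_l omega l S : set (R * R -> R[i]) :=
  [set f | holomorphic S f /\
    has_ubound [set Normc.normc (cderiven p f z) / weight_seq omega l p |
                z in S & p in [set: nat]]].

Definition Lambda_l omega l : set (nat -> R[i]) :=
  [set a | has_ubound [set Normc.normc (a p) / weight_seq omega l p |
                       p in [set: nat]]].

Definition ultraholomorphic_Beurling omega S : set (R * R -> R[i]) :=
  \bigcap_(l in [set l : R | 0 < l]) ultraholomorphic_l omega l S.

Definition Lambda_Beurling omega : set (nat -> R[i]) :=
  \bigcap_(l in [set l : R | 0 < l]) Lambda_l omega l.

End Spaces.

(* Main.v *)
(* Let 1 + gamma < 1 + b < gamma(omega) and al = 1 / b, so that al * gamma < 1 and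
   z^(-al) has positive real part, comparable with its modulus, on the sector. For
   N close to b p and s = lam z^(-al), the function
     G_N(s) = 1 - e^(-s) (1 + s + ... + s^(N-1) / (N-1)!)
   differs from 1 by a flat function at z = 0 and is O(s^N) for small s. Hence
     f(z) = sum_p (a_p / p!) z^p G_(N_p)(lam_p z^(-al))
   is a Borel-Ritt sum, whose p-th term is cut off where |s| = N_p, that is at
   |z| = 1 / x_p with lam_p = N_p x_p^(-al). As
     d/dz (z^m G_N) = z^(m-1) ((m - al N) G_N + al N G_(N+1)),
   all derivatives are finite combinations of the same functions, which gives
     |f_p^(k)| <= |a_p| C^(p+k+1) X_p^(k-p) max(1, k/(p+1))^((1+b) k),  X_p = (p+1) x_p,
   with no recourse to Cauchy's formula. It remains to choose the X_p. With
   rho = 1 / (1 + b), the smoothing psi(j) = sum_i e^(-rho i) omega(e^(j+i)) is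
   equivalent to j |-> omega(e^j), because 1 + b < gamma(omega), and its increments
   grow at most like e^(rho j). One takes X_p = e^(j_p + B) where j_p maximizes
   p j - n psi(j), with n = n_p tending to infinity slowly enough to serve all the
   Beurling bounds simultaneously.
   In the coordinate zeta = log z the sector becomes a strip, which is convex. *)
Require Import Defs.
From mathcomp Require Import all_boot all_order all_algebra.
From mathcomp Require Import all_classical all_reals all_analysis.
From mathcomp Require Import complex.
From mathcomp Require Import ring lra.

Set Implicit Arguments.
Unset Strict Implicit.
Unset Printing Implicit Defensive.

Import Order.TTheory GRing.Theory Num.Theory.
Import numFieldNormedType.Exports.

Local Open Scope classical_set_scope.
Local Open Scope complex_scope.
Local Open Scope ring_scope.

Local Notation cabs := Normc.normc.
Local Notation Re := complex.Re.
Local Notation Im := complex.Im.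

(** * Mean value inequalities *)

Section RealMeanValue.
Context {R : realType}.
Implicit Types f df d2f b db g dg : R -> R.

Lemma is_derive_near_quadratic f (t d M e : R) : 0 < e ->
  (forall u, `|u| < e -> `|f (t + u) - f t - d * u| <= M * u ^+ 2) ->
  is_derive t (1 : R) f d.
Proof.
move=> e0 H.
have cv : h^-1 *: ((f \o shift t) (h *: (1:R)) - f t) @[h --> 0^'] --> d.
  apply/cvgrPdist_lt => eps eps0; near=> h.
  have hn0 : h != 0 by near: h; exact: nbhs_dnbhs_neq.
  have hM : `|h| * (`|M| + 1) < eps.
    rewrite -ltr_pdivlMr; last by rewrite ltr_wpDl.
    near: h; apply: dnbhs0_lt; by rewrite divr_gt0 // ltr_wpDl.
  have he : `|h| < e by near: h; exact: dnbhs0_lt.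
  have := H _ he.
  rewrite /= /GRing.scale /= mulr1 (addrC t h) => K.
  have -> : d - h^-1 * (f (h + t) - f t) = - h^-1 * (f (h + t) - f t - d * h).
    by field.
  rewrite normrM normrN normfV mulrC ltr_pdivrMr ?normr_gt0 //.
  apply: le_lt_trans K _.
  apply: (@le_lt_trans _ _ (`|h| * (`|M| + 1) * `|h|)); last first.
    by rewrite ltr_pM2r ?normr_gt0.
  rewrite -(real_normK (num_real h)).
  have := ler_norm M; have := normr_ge0 h; nra.
split; last by apply/cvg_lim.
by apply/cvg_ex; exists d.
Unshelve. all: by end_near. Qed.

(* The derivative of [f - b] and of [- f - b] is nonpositive. *)
Lemma mean_value_majorant f df b db :
  (forall t : R, 0 <= t <= 1 -> is_derive t (1 : R) f (df t)) ->
  (forall t : R, 0 <= t <= 1 -> is_derive t (1 : R) b (db t)) ->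
  (forall t : R, 0 <= t <= 1 -> `|df t| <= db t) ->
  `|f 1 - f 0| <= b 1 - b 0.
Proof.
move=> hf hb hle.
have cvc g dg : (forall t : R, 0 <= t <= 1 -> is_derive t (1 : R) g (dg t)) ->
    {within `[0, 1], continuous g}.
  move=> hg; apply: derivable_within_continuous => t.
  by rewrite in_itv /= => /hg [].
have itv01 (t : R) : t \in `]0, 1[ -> 0 <= t <= 1.
  by rewrite in_itv /= => /andP[/ltW -> /ltW ->].
have aux g dg : (forall t : R, 0 <= t <= 1 -> is_derive t (1 : R) g (dg t)) ->
    (forall t : R, 0 <= t <= 1 -> dg t <= db t) -> g 1 - g 0 <= b 1 - b 0.
  move=> hg hgb.
  have hd (t : R) : 0 <= t <= 1 -> is_derive t (1 : R) (g \- b) (dg t - db t).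
    by move=> ht; have := hg _ ht; have := hb _ ht => ? ?; exact: is_deriveB.
  have [|c cI] := MVT (ltr01 : (0 : R) < 1) (fun t ht => hd t (itv01 t ht)).
    exact: cvc hd.
  rewrite /= subr0 mulr1 => E; have := hgb _ (itv01 _ cI); lra.
rewrite ler_norml; apply/andP; split; last first.
  by apply: (aux f df) => // t ht; exact: le_trans (ler_norm _) (hle _ ht).
have := aux (- f) (fun t => - df t).
have E : (- f) 1 - (- f) 0 = - (f 1 - f 0) by rewrite !fctE; ring.
rewrite E => K; rewrite lerNl; apply: K => t ht.
  by have := hf _ ht => ?; exact: is_deriveN.
by apply: le_trans (hle _ ht); rewrite -normrN ler_norm.
Qed.

(** Two mean value estimates in a row: [df] stays within [M] of [df 0] on the unit interval, hence
    [f] minus its linear part varies by at most [M]. The factor one half of Taylor's formula is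
    given away. *)
Lemma taylor2_majorant f df d2f (M : R) :
  (forall t : R, 0 <= t <= 1 -> is_derive t (1 : R) f (df t)) ->
  (forall t : R, 0 <= t <= 1 -> is_derive t (1 : R) df (d2f t)) ->
  (forall t : R, 0 <= t <= 1 -> `|d2f t| <= M) ->
  `|f 1 - f 0 - df 0| <= M.
Proof.
move=> h1 h2 hM.
have lin (c : R) : forall t : R, is_derive t (1 : R) (fun u : R => u * c) c.
  move=> t; apply: is_derive_eq; rewrite /GRing.scale /=; ring.
have hdf (t : R) : 0 <= t <= 1 -> `|df t - df 0| <= M.
  move=> ht; move: (ht) => /andP[t0 t1].
  have M0 : 0 <= M by apply: le_trans (hM _ ht).
  have sub (u : R) : 0 <= u <= 1 -> 0 <= u * t <= 1 by move=> ?; nra.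
  have := @mean_value_majorant (df \o (fun u => u * t)) (fun u => d2f (u * t) * t)
     (fun u => u * M) (fun=> M).
  rewrite /= mul1r mul0r mul1r mul0r subr0; apply.
  - move=> u hu; have := h2 _ (sub u hu); have := lin t u => ? ?.
    by apply: is_derive_eq (is_derive1_comp _ _) _ => //; rewrite mulrC.
  - move=> u hu; rewrite normrM (ger0_norm t0).
    have := hM _ (sub u hu); have := normr_ge0 (d2f (u * t)); nra.
have := @mean_value_majorant (fun t => f t - t * df 0) (fun t => df t - df 0)
     (fun u => u * M) (fun=> M).
rewrite !mul1r !mul0r !subr0 (_ : f 1 - df 0 - f 0 = f 1 - f 0 - df 0); last by ring.
apply => //.
by move=> t ht; have := h1 _ ht; have := lin (df 0) t => ? ?; exact: is_deriveB.
Qed.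

End RealMeanValue.

(** * Complex modulus and exponential *)

Section ComplexModulus.
Context {R : realType}.
Local Notation C := R[i].
Implicit Types x y z : C.

Lemma cabs_ge0 x : 0 <= cabs x.
Proof. by case: x => a b; exact: sqrtr_ge0. Qed.

Lemma cabsD x y : cabs (x + y) <= cabs x + cabs y.
Proof. exact: (@le_normcD R x y). Qed.

Lemma cabsN x : cabs (- x) = cabs x.
Proof. exact: (@normcN R x). Qed.

Lemma cabsB x y : cabs (x - y) <= cabs x + cabs y.
Proof. by rewrite -(cabsN y) cabsD. Qed.

Lemma cabsX x n : cabs (x ^+ n) = cabs x ^+ n.
Proof.
elim: n => [|n IH]; first by rewrite !expr0 Normc.normc1.
by rewrite !exprS Normc.normcM IH.
Qed.

Lemma cabs_real (r : R) : cabs r%:C = `|r|.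
Proof. by rewrite /= expr0n /= addr0 sqrtr_sqr. Qed.

Lemma cabs_nat n : cabs (n%:R : C) = n%:R.
Proof. by rewrite -(rmorph_nat (real_complex R)) cabs_real ger0_norm. Qed.

Lemma normr_Re_le x : `|Re x| <= cabs x.
Proof.
by case: x => a b /=; rewrite -sqrtr_sqr ler_wsqrtr // lerDl sqr_ge0.
Qed.

Lemma normr_Im_le x : `|Im x| <= cabs x.
Proof.
by case: x => a b /=; rewrite -sqrtr_sqr ler_wsqrtr // lerDr sqr_ge0.
Qed.

Lemma cabs_le_ReIm x : cabs x <= `|Re x| + `|Im x|.
Proof.
case: x => a b /=.
rewrite -(ger0_norm (addr_ge0 (normr_ge0 a) (normr_ge0 b))) -sqrtr_sqr ler_wsqrtr //.
rewrite -(real_normK (num_real a)) -(real_normK (num_real b)).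
have := normr_ge0 a; have := normr_ge0 b; nra.
Qed.

Lemma cabs_sum (I : Type) (r : seq I) (P : pred I) (F : I -> C) :
  cabs (\sum_(i <- r | P i) F i) <= \sum_(i <- r | P i) cabs (F i).
Proof.
elim/big_ind2: _ => [|x1 x2 y1 y2 h1 h2|//]; first by rewrite Normc.normc0.
by apply: le_trans (cabsD _ _) _; exact: lerD.
Qed.

Definition cexp z : C :=
  (expR (Re z) * cos (Im z)) +i* (expR (Re z) * sin (Im z)).

Lemma cexpD x y : cexp (x + y) = cexp x * cexp y.
Proof.
case: x y => [a b] [c d]; rewrite /cexp /= expRD cosD sinD.
by apply/eqP; rewrite eq_complex /=; apply/andP; split; apply/eqP; ring.
Qed.

Lemma cexp0 : cexp 0 = 1.
Proof. by rewrite /cexp /= expR0 cos0 sin0 mulr1 mulr0. Qed.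

Lemma cabs_cexp x : cabs (cexp x) = expR (Re x).
Proof.
rewrite /cexp /= !exprMn -mulrDr cos2Dsin2 mulr1 sqrtr_sqr ger0_norm //.

Qed.

Lemma cexp_neq0 x : cexp x != 0.
Proof.
apply/eqP => h; have := cabs_cexp x; rewrite h Normc.normc0 => /esym/eqP.
by rewrite gt_eqF // expR_gt0.
Qed.

(** Square of e^(1/2) <= 2, which is the inverse of e^(-1/2) >= 1 - 1/2. *)
Lemma expR1_le4 : expR 1 <= 4 :> R.
Proof.
have h := expR_ge1Dx (- 2^-1 : R).
have p : expR (2^-1 : R) * expR (- 2^-1) = 1 by rewrite -expRD subrr expR0.
have -> : (1 : R) = 2^-1 + 2^-1 by lra.
rewrite expRD; have := expR_ge0 (2^-1 : R); nra.
Qed.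

(** Taylor estimate for t |-> e^(t a) on the unit interval, whose second derivative is at most 4 a^2
    because e <= 4. Cosine and sine follow the same pattern. *)
Lemma expR_quadratic (a : R) : `|a| <= 1 -> `|expR a - 1 - a| <= 4 * a ^+ 2.
Proof.
move=> a1.
have lin (t : R) : is_derive t (1 : R) (fun u : R => u * a) a.
  by apply: is_derive_eq; rewrite /GRing.scale /=; ring.
have e3 (t : R) : 0 <= t <= 1 -> expR (t * a) <= 4.
  move=> /andP[t0 t1]; have : expR (t * a) <= expR 1.
    rewrite ler_expR; have := ler_norm a; nra.
  by move/le_trans; apply; exact: expR1_le4.
have dE (t : R) : is_derive t (1 : R) (fun u : R => expR (u * a)) (expR (t * a) * a).
  have := lin t => ?; apply: is_derive_eq; rewrite /GRing.scale /=; ring.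
have := @taylor2_majorant R (fun t => expR (t * a)) (fun t => expR (t * a) * a)
  (fun t => expR (t * a) * a ^+ 2) (4 * a ^+ 2).
rewrite !mul1r !mul0r expR0 mul1r; apply => //.
- move=> t _; have := dE t => ?.
  apply: (is_derive_eq (is_deriveM (dE t) (is_derive_cst a t 1))).
  rewrite /GRing.scale /=; ring.
- move=> t ht; rewrite normrM ger0_norm ?expR_ge0 // ger0_norm ?sqr_ge0 //.
  by rewrite ler_wpM2r ?sqr_ge0 ?e3.
Qed.

Lemma cos_quadratic (b : R) : `|cos b - 1| <= b ^+ 2.
Proof.
have lin (t : R) : is_derive t (1 : R) (fun u : R => u * b) b.
  by apply: is_derive_eq; rewrite /GRing.scale /=; ring.
have dS (t : R) : is_derive t (1 : R) (fun u : R => sin (u * b)) (cos (t * b) * b).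
  have := lin t => ?; apply: is_derive_eq; rewrite /GRing.scale /=; ring.
have := @taylor2_majorant R (fun t => cos (t * b)) (fun t => - sin (t * b) * b)
  (fun t => - cos (t * b) * b ^+ 2) (b ^+ 2).
rewrite !mul1r !mul0r cos0 sin0 oppr0 mul0r subr0; apply.
- move=> t _.
  apply: (is_derive_eq (is_deriveM (is_deriveN (dS t)) (is_derive_cst b t 1))).
  rewrite /GRing.scale /=; ring.
- move=> t ht; rewrite normrM normrN ger0_norm ?sqr_ge0 //.
  by rewrite ler_piMl ?sqr_ge0 // ler_norml cos_le1 cos_geN1.
Qed.

Lemma sin_quadratic (b : R) : `|sin b - b| <= b ^+ 2.
Proof.
have lin (t : R) : is_derive t (1 : R) (fun u : R => u * b) b.
  by apply: is_derive_eq; rewrite /GRing.scale /=; ring.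
have dS (t : R) : is_derive t (1 : R) (fun u : R => cos (u * b)) (- sin (t * b) * b).
  have := lin t => ?; apply: is_derive_eq; rewrite /GRing.scale /=; ring.
have := @taylor2_majorant R (fun t => sin (t * b)) (fun t => cos (t * b) * b)
  (fun t => - sin (t * b) * b ^+ 2) (b ^+ 2).
rewrite !mul1r !mul0r cos0 sin0 mul1r subr0; apply.
- move=> t _.
  apply: (is_derive_eq (is_deriveM (dS t) (is_derive_cst b t 1))).
  rewrite /GRing.scale /=; ring.
- move=> t ht; rewrite normrM normrN ger0_norm ?sqr_ge0 //.
  by rewrite ler_piMl ?sqr_ge0 // ler_norml sin_le1 sin_geN1.
Qed.

(** These are the real and imaginary parts of e^(a+ib) - 1 - (a+ib), written out so that the three
    real estimates above combine; their constants add up to 17. *)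
Lemma exp_polar_quadratic (a b r : R) : r <= 1 -> `|a| <= r -> `|b| <= r ->
  `|expR a * cos b - 1 - a| + `|expR a * sin b - b| <= 20 * r ^+ 2.
Proof.
move=> r1 ha hb; have r0 : 0 <= r := le_trans (normr_ge0 a) ha.
have a2 : a ^+ 2 <= r ^+ 2 by rewrite -(real_normK (num_real a)); have := normr_ge0 a; nra.
have b2 : b ^+ 2 <= r ^+ 2 by rewrite -(real_normK (num_real b)); have := normr_ge0 b; nra.
have Ea := expR_quadratic (le_trans ha r1).
have Cb := cos_quadratic b; have Sb := sin_quadratic b.
have e3 : expR a <= 4.
  apply: (@le_trans _ _ (expR 1)); last exact: expR1_le4.
  by rewrite ler_expR; apply: le_trans (ler_norm a) (le_trans ha r1).
have e0 := expR_ge0 a.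
have E1 : `|expR a - 1| <= 5 * r.
  rewrite (_ : expR a - 1 = (expR a - 1 - a) + a); last by ring.
  apply: le_trans (ler_normD _ _) _; nra.
have -> : expR a * cos b - 1 - a = (expR a - 1 - a) + expR a * (cos b - 1) by ring.
have -> : expR a * sin b - b = (expR a - 1) * b + expR a * (sin b - b) by ring.
have N1 : `|expR a * (cos b - 1)| <= 4 * r ^+ 2.
  rewrite normrM (ger0_norm e0); have := normr_ge0 (cos b - 1); nra.
have N2 : `|expR a * (sin b - b)| <= 4 * r ^+ 2.
  rewrite normrM (ger0_norm e0); have := normr_ge0 (sin b - b); nra.
have N3 : `|(expR a - 1) * b| <= 5 * r ^+ 2.
  rewrite normrM; have := normr_ge0 (expR a - 1); have := normr_ge0 b; nra.
have M1 := ler_normD (expR a - 1 - a) (expR a * (cos b - 1)).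
have M2 := ler_normD ((expR a - 1) * b) (expR a * (sin b - b)).
have := sqr_ge0 r; lra.
Qed.

Lemma cexp_quadratic h : cabs h <= 1 -> cabs (cexp h - 1 - h) <= 20 * cabs h ^+ 2.
Proof.
move=> h1; apply: le_trans (cabs_le_ReIm _) _.
have := exp_polar_quadratic h1 (normr_Re_le h) (normr_Im_le h).
by case: h {h1} => a b /=; rewrite ?oppr0 ?addr0 ?subr0.
Qed.

End ComplexModulus.

(** * Complex derivatives *)

Section ComplexDerivative.
Context {R : realType}.
Local Notation C := R[i].
Implicit Types (F G : C -> C) (z h d : C).

(* A quadratic remainder bound is much stronger than complex differentiability,
   but it holds for every function used here and is stable under sums of series. *)
Definition has_cderiv F z d := exists M e : R, [/\ 0 <= M, 0 < e &
  forall h, cabs h < e -> cabs (F (z + h) - F z - d * h) <= M * cabs h ^+ 2].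

Lemma has_cderiv_eq F z d d' : has_cderiv F z d -> d = d' -> has_cderiv F z d'.
Proof. by move=> + <-. Qed.

Lemma has_cderiv_cst c z : has_cderiv (fun=> c) z 0.
Proof.
exists 0, 1; split => // h _.
by rewrite subrr mul0r subr0 Normc.normc0 mul0r.
Qed.

Lemma has_cderiv_lin c z : has_cderiv (fun w => c * w) z c.
Proof.
exists 0, 1; split => // h _.
rewrite (_ : _ - _ = 0); last by ring.
by rewrite Normc.normc0 mul0r.
Qed.

Lemma has_cderivD F G z d1 d2 : has_cderiv F z d1 -> has_cderiv G z d2 ->
  has_cderiv (fun w => F w + G w) z (d1 + d2).
Proof.
move=> [M1 [e1 [M10 e10 h1]]] [M2 [e2 [M20 e20 h2]]].
exists (M1 + M2), (Num.min e1 e2); split; [exact: addr_ge0| by rewrite lt_min e10|].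
move=> h; rewrite lt_min => /andP[he1 he2].
rewrite (_ : _ - _ = (F (z + h) - F z - d1 * h) + (G (z + h) - G z - d2 * h)); last by ring.
apply: le_trans (cabsD _ _) _; rewrite mulrDl; apply: lerD; [exact: h1|exact: h2].
Qed.

Lemma has_cderivZ c F z d : has_cderiv F z d -> has_cderiv (fun w => c * F w) z (c * d).
Proof.
move=> [M [e [M0 e0 H]]]; exists (cabs c * M), e; split => //.
  by rewrite mulr_ge0 ?cabs_ge0.
move=> h he; rewrite (_ : _ - _ = c * (F (z + h) - F z - d * h)); last by ring.
by rewrite Normc.normcM -mulrA ler_wpM2l ?cabs_ge0 ?H.
Qed.

Lemma has_cderiv_exp F z d : has_cderiv F z d ->
  has_cderiv (fun w => cexp (F w)) z (cexp (F z) * d).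
Proof.
move=> [M [e [M0 e0 H]]].
(* The increment of [F] is at most [A * cabs h]; the radius [A^-1] keeps it below 1, as
   [cexp_quadratic] requires. *)
set A := cabs d + M * e + 1.
have A0 : 0 < A by rewrite ltr_wpDl // addr_ge0 ?cabs_ge0 // mulr_ge0 // ltW.
exists (cabs (cexp (F z)) * (20 * A ^+ 2 + M)), (Num.min e A^-1); split.
- by rewrite mulr_ge0 ?cabs_ge0 // addr_ge0 // mulr_ge0 // sqr_ge0.
- by rewrite lt_min e0 invr_gt0.
move=> h; rewrite lt_min => /andP[he hA].
have := H _ he; set k := F (z + h) - F z => Hk.
have h0 := cabs_ge0 h.
have Kk : cabs k <= A * cabs h.
  rewrite (_ : k = (k - d * h) + d * h); last by ring.
  apply: le_trans (cabsD _ _) _; rewrite Normc.normcM /A.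
  have : M * cabs h ^+ 2 <= M * e * cabs h.
    by rewrite expr2 mulrA ler_wpM2r // ler_wpM2l // ltW.
  lra.
have k1 : cabs k <= 1.
  apply: le_trans Kk _; rewrite mulrC -ler_pdivlMr // div1r; exact: ltW.
rewrite (_ : _ - _ = cexp (F z) * ((cexp k - 1 - k) + (k - d * h))); last first.
  by rewrite (_ : F (z + h) = F z + k) ?cexpD /k; ring.
rewrite Normc.normcM -mulrA ler_wpM2l ?cabs_ge0 //.
apply: le_trans (cabsD _ _) _; rewrite mulrDl; apply: lerD => //.
apply: le_trans (cexp_quadratic k1) _; rewrite -mulrA ler_wpM2l //.
by rewrite -exprMn lerXn2r // nnegrE ?cabs_ge0 // mulr_ge0 // ltW.
Qed.

Lemma is_derive_Re F z h (t : R) d : has_cderiv F (z + t%:C * h) d ->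
  is_derive t (1 : R) (fun u : R => Re (F (z + u%:C * h))) (Re (d * h)).
Proof.
move=> [M [e [M0 e0 H]]].
have p : 0 < cabs h + 1 by rewrite ltr_wpDl ?cabs_ge0.
apply: (@is_derive_near_quadratic _ _ _ _ (M * cabs h ^+ 2) (e / (cabs h + 1))).
  by rewrite divr_gt0.
move=> u; rewrite ltr_pdivlMr // => hu.
have hh : cabs (u%:C * h) < e.
  rewrite Normc.normcM cabs_real.
  apply: le_lt_trans hu; rewrite ler_wpM2l // ; have := cabs_ge0 h; lra.
rewrite (_ : M * cabs h ^+ 2 * u ^+ 2 = M * cabs (u%:C * h) ^+ 2); last first.
  by rewrite Normc.normcM cabs_real exprMn (real_normK (num_real u)); ring.
apply: le_trans (H _ hh); apply: le_trans (normr_Re_le _).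
rewrite rmorphD /= mulrDl addrA.
set P := F _; set Q := F _.
by case: P => a b; case: Q => c f; case: (d) => p1 p2; case: (h) => h1 h2 /=;
  rewrite le_eqVlt; apply/orP; left; apply/eqP; congr (`| _ |); ring.
Qed.

Lemma is_derive_Im F z h (t : R) d : has_cderiv F (z + t%:C * h) d ->
  is_derive t (1 : R) (fun u : R => Im (F (z + u%:C * h))) (Im (d * h)).
Proof.
(* Multiplication by -i turns imaginary parts into real parts. *)
move=> /(has_cderivZ (0 -i* 1)) /is_derive_Re.
rewrite (_ : (fun _ => _) = fun u : R => Im (F (z + u%:C * h))); last first.
  by apply/funext => u; case: (F _) => a b /=; ring.
by case: d h => [a b] [c d] /=; congr is_derive; ring.
Qed.

Lemma ReB (x y : C) : Re (x - y) = Re x - Re y.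
Proof. by case: x y => [? ?] []. Qed.

Lemma ImB (x y : C) : Im (x - y) = Im x - Im y.
Proof. by case: x y => [? ?] []. Qed.

(** Real and imaginary parts are majorized separately along the segment, whence the factor 2. *)
Lemma cderiv_mean_value F dF z h (b db : R -> R) :
  (forall t : R, 0 <= t <= 1 -> has_cderiv F (z + t%:C * h) (dF (z + t%:C * h))) ->
  (forall t : R, 0 <= t <= 1 -> is_derive t (1 : R) b (db t)) ->
  (forall t : R, 0 <= t <= 1 -> cabs (dF (z + t%:C * h) * h) <= db t) ->
  cabs (F (z + h) - F z) <= 2 * (b 1 - b 0).
Proof.
move=> hF hb hle; apply: le_trans (cabs_le_ReIm _) _.
have e1 : z + h = z + (1 : R)%:C * h by rewrite mul1r.
have e0 : z = z + (0 : R)%:C * h by rewrite mul0r addr0.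
rewrite ReB ImB mulr2n mulrDl mul1r; apply: lerD.
- have := mean_value_majorant (f := fun t : R => Re (F (z + t%:C * h)))
    (df := fun t => Re (dF (z + t%:C * h) * h)) _ hb.
  rewrite -e1 -e0; apply => t ht; first exact/is_derive_Re/hF.
  exact: le_trans (normr_Re_le _) (hle _ ht).
- have := mean_value_majorant (f := fun t : R => Im (F (z + t%:C * h)))
    (df := fun t => Im (dF (z + t%:C * h) * h)) _ hb.
  rewrite -e1 -e0; apply => t ht; first exact/is_derive_Im/hF.
  exact: le_trans (normr_Im_le _) (hle _ ht).
Qed.

Lemma cderiv_taylor2 F dF d2F z h (M : R) :
  (forall t : R, 0 <= t <= 1 -> has_cderiv F (z + t%:C * h) (dF (z + t%:C * h))) ->
  (forall t : R, 0 <= t <= 1 -> has_cderiv dF (z + t%:C * h) (d2F (z + t%:C * h))) ->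
  (forall t : R, 0 <= t <= 1 -> cabs (d2F (z + t%:C * h)) <= M) ->
  cabs (F (z + h) - F z - dF z * h) <= 2 * M * cabs h ^+ 2.
Proof.
move=> hF hdF hle; apply: le_trans (cabs_le_ReIm _) _.
have e1 : z + h = z + (1 : R)%:C * h by rewrite mul1r.
have e0 : z = z + (0 : R)%:C * h by rewrite mul0r addr0.
have hb t : 0 <= t <= 1 -> cabs (d2F (z + t%:C * h) * h * h) <= M * cabs h ^+ 2.
  by move=> ht; rewrite !Normc.normcM -mulrA ler_wpM2r ?hle // mulr_ge0 ?cabs_ge0.
have hG t : 0 <= t <= 1 ->
    has_cderiv (fun w => h * dF w) (z + t%:C * h) (h * d2F (z + t%:C * h)).
  by move=> ht; exact/has_cderivZ/hdF.
rewrite !ReB !ImB -mulrA mulr2n mulrDl mul1r; apply: lerD.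
- have := @taylor2_majorant R (fun t : R => Re (F (z + t%:C * h)))
    (fun t => Re (dF (z + t%:C * h) * h))
    (fun t => Re (h * d2F (z + t%:C * h) * h)) (M * cabs h ^+ 2).
  rewrite -e1 -e0; apply => t ht.
  + exact/is_derive_Re/hF.
  + have := is_derive_Re (hG _ ht).
    by under eq_fun do rewrite mulrC.
  + by apply: le_trans (normr_Re_le _) _; rewrite (mulrC h); exact: hb.
- have := @taylor2_majorant R (fun t : R => Im (F (z + t%:C * h)))
    (fun t => Im (dF (z + t%:C * h) * h))
    (fun t => Im (h * d2F (z + t%:C * h) * h)) (M * cabs h ^+ 2).
  rewrite -e1 -e0; apply => t ht.
  + exact/is_derive_Im/hF.
  + have := is_derive_Im (hG _ ht).
    by under eq_fun do rewrite mulrC.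
  + by apply: le_trans (normr_Im_le _) _; rewrite (mulrC h); exact: hb.
Qed.

End ComplexDerivative.

(** * The logarithmic chart *)

Section LogChart.
Context {R : realType}.
Local Notation C := R[i].
Implicit Types (F : C -> C) (f g : R * R -> C) (w z : R * R) (S : set (R * R)).

Definition logc w : C := ln w.1 +i* w.2.

Lemma normr_cabs (x : C) : `|x| = (cabs x)%:C.
Proof. by rewrite normc_def; case: x. Qed.

Lemma covering_cexp w : 0 < w.1 -> covering w = cexp (logc w).
Proof. by move=> w0; rewrite /covering /cexp /= lnK. Qed.

(** By the chain rule, derivative [cexp zeta * d] in zeta means derivative [d] in e^zeta. The
    numerator error and e^h - 1 - h are both quadratic in h, while the denominator is at least
    linear in h. *)
Lemma diff_quotient_cexp F (zeta d : C) (eps : R) :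
  has_cderiv F zeta (cexp zeta * d) -> 0 < eps ->
  exists2 del : R, 0 < del & forall h, h != 0 -> cabs h < del ->
    cabs (d - (F (zeta + h) - F zeta) / (cexp (zeta + h) - cexp zeta)) < eps.
Proof.
move=> [M [e [M0 e0 H]]] eps0.
set E := cexp zeta in H *; set A := cabs E.
have E0 : E != 0 by exact: cexp_neq0.
have A0 : 0 < A by rewrite /A cabs_cexp expR_gt0.
set B := M + 20 * cabs (E * d) + 1.
have B0 : 0 < B by rewrite ltr_wpDl // addr_ge0 // mulr_ge0 // cabs_ge0.
(* Below 1/40 the error 20 |h|^2 is at most |h| / 2, which bounds e^h - 1 away from 0; the last
   entry makes B |h|^2 smaller than eps A |h| / 2. *)
exists (Num.min (Num.min e 40^-1) (eps * A / (2 * B))).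
  rewrite !lt_min e0 invr_gt0 ltr0n /=.
  by rewrite divr_gt0 ?mulr_gt0.
move=> h h0; rewrite !lt_min => /andP[/andP[he h40] hB].
have ch0 : 0 < cabs h.
  rewrite lt_def cabs_ge0 andbT; apply: contra h0 => /eqP h0.
  by rewrite (Normc.eq0_normc h0).
have q := cexp_quadratic (le_trans (ltW h40) _); rewrite -/E.
have {}q : cabs (cexp h - 1 - h) <= 20 * cabs h ^+ 2 by apply: q; lra.
have lowD : cabs h / 2 <= cabs (cexp h - 1).
  have := cabsD (cexp h - 1) (- (cexp h - 1 - h)); rewrite cabsN.
  rewrite (_ : cexp h - 1 - (cexp h - 1 - h) = h); last by ring.
  nra.
have D0 : cexp h - 1 != 0.
  apply/eqP => D0; move: lowD; rewrite D0 Normc.normc0; lra.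
rewrite cexpD -/E (_ : d - _ =
  ((E * d) * (cexp h - 1 - h) - (F (zeta + h) - F zeta - E * d * h)) * (E * (cexp h - 1))^-1);
 last first.
  field; rewrite D0 E0 (_ : E * cexp h - E = E * (cexp h - 1)); last by ring.
  by rewrite mulf_neq0.
rewrite Normc.normcM Normc.normcV Normc.normcM -/A ltr_pdivrMr; last first.
  by rewrite mulr_gt0 //; nra.
apply: le_lt_trans (cabsB _ _) _.
have H1 := H _ he.
rewrite Normc.normcM.
have H2 : cabs (E * d) * cabs (cexp h - 1 - h) + M * cabs h ^+ 2 <= B * cabs h ^+ 2.
  have : cabs (E * d) * cabs (cexp h - 1 - h) <= cabs (E * d) * (20 * cabs h ^+ 2).
    by rewrite ler_wpM2l ?cabs_ge0.
  rewrite /B; nra.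
apply: (@le_lt_trans _ _ (B * cabs h ^+ 2)); first lra.
have H3 : B * cabs h < eps * A / 2.
  by move: hB; rewrite invfM mulrA ltr_pdivlMr // mulrC.
have : 0 < eps * A by exact: mulr_gt0.
nra.
Qed.

Lemma logc_inj w z : 0 < w.1 -> 0 < z.1 -> logc w = logc z -> w = z.
Proof.
by case: w z => [a b] [c d] /= a0 c0 [/ln_inj ac ->]; rewrite ac ?posrE.
Qed.

Lemma near_logc z (del : R) : 0 < z.1 -> 0 < del ->
  \forall w \near z, 0 < w.1 /\ cabs (logc w - logc z) < del.
Proof.
move=> z0 d0.
have d2 : 0 < del / 2 by rewrite divr_gt0.
have c1 : ln w.1 @[w --> z] --> ln z.1.
  by apply: cvg_comp; [exact: cvg_fst|exact: continuous_ln].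
have c2 : w.2 @[w --> z] --> z.2 by exact: cvg_snd.
have p1 : \forall w \near z, 0 < w.1.
  have c0 : w.1 @[w --> z] --> z.1 by exact: cvg_fst.
  exact: (cvgr_gt _ c0 _ z0).
move/cvgrPdist_lt/(_ _ d2): c1 => n1; move/cvgrPdist_lt/(_ _ d2): c2 => n2.
near=> w; split; first by near: w.
apply: le_lt_trans (cabs_le_ReIm _) _ => /=.
have : `|ln z.1 - ln w.1| < del / 2 by near: w; exact: n1.
have : `|z.2 - w.2| < del / 2 by near: w; exact: n2.
rewrite distrC (distrC (ln _)); lra.
Unshelve. all: by end_near. Qed.

Lemma dnbhs_proper z : ProperFilter z^'.
Proof.
split; last exact: dnbhs_filter.
move=> /nbhs_ballP[e /= e0 he].
have := he (z.1 + e / 2, z.2); apply.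
  split => /=; last exact: ballxx.
  rewrite /ball /= opprD addNKr normrN gtr0_norm ?divr_gt0 //; lra.
apply/eqP => /(congr1 fst) /= h.
have : e / 2 = 0 by lra.
by move/eqP; rewrite gt_eqF // divr_gt0.
Qed.

Lemma diff_quotient_cvg F f z d : 0 < z.1 ->
  has_cderiv F (logc z) (cexp (logc z) * d) ->
  (\forall w \near z, f w = F (logc w)) ->
  diff_quotient f z w @[w --> z^'] --> d.
Proof.
move=> z0 hF hf; apply/cvgrPdist_lt => eps eps0.
(* In the order of the complex numbers a positive element is real. *)
have [e E] : exists e : R, eps = e%:C.
  by exists (Re eps); rewrite RRe_real // gtr0_real.
rewrite {}E ltcR in eps0 *.
have [del d0 H] := diff_quotient_cexp hF eps0.
have := near_logc z0 d0 => hl.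
have hfz : f z = F (logc z) by exact: nbhs_singleton hf.
near=> w.
have wz : w != z by near: w; exact: nbhs_dnbhs_neq.
have [w0 wd] : 0 < w.1 /\ cabs (logc w - logc z) < del.
  by near: w; apply: nbhs_dnbhs.
have fw : f w = F (logc w) by near: w; apply: nbhs_dnbhs.
rewrite normr_cabs ltcR.
rewrite /diff_quotient fw hfz !covering_cexp //.
have := H (logc w - logc z) _ wd; rewrite (addrC (logc z)) subrK; apply.
by rewrite subr_eq0; apply: contra wz => /eqP/(logc_inj w0 z0)->.
Unshelve. all: by end_near. Qed.

Lemma cderive_logc F f z d : 0 < z.1 ->
  has_cderiv F (logc z) (cexp (logc z) * d) ->
  (\forall w \near z, f w = F (logc w)) -> cderive f z = d.
Proof.
move=> z0 hF hf; have P := dnbhs_proper z.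
by apply: cvg_lim; [exact: norm_hausdorff|exact: diff_quotient_cvg hf].
Qed.

Lemma open_sector (gamma : R) z : sector gamma z -> \forall w \near z, sector gamma w.
Proof.
move=> [z0 zt].
have p1 : \forall w \near z, 0 < w.1.
  have c0 : w.1 @[w --> z] --> z.1 by exact: cvg_fst.
  exact: (cvgr_gt _ c0 _ z0).
have p2 : \forall w \near z, `|w.2| < gamma * pi / 2.
  have c2 : `|w.2| @[w --> z] --> `|z.2| by apply: cvg_norm; exact: cvg_snd.
  exact: (cvgr_lt _ c2 _ zt).
by near=> w; split; near: w.
Unshelve. all: by end_near. Qed.

(** Induction on k: the sector is open, so the formula for the k-th derivative holds near z and may
    be differentiated there. *)
Lemma cderiven_logc (gamma : R) (F_ : nat -> C -> C) f :
  (forall k z, sector gamma z ->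
     has_cderiv (F_ k) (logc z) (cexp (logc z) * F_ k.+1 (logc z))) ->
  (forall z, sector gamma z -> f z = F_ 0%N (logc z)) ->
  forall k z, sector gamma z -> cderiven k f z = F_ k (logc z).
Proof.
move=> hF hf; elim => [|k IH] z Sz; first exact: hf.
rewrite /cderiven iterS; apply: (cderive_logc _ (hF k z Sz)); first by case: Sz.
by apply: filterS (open_sector Sz) => w; exact: IH.
Qed.

Lemma holomorphic_logc (gamma : R) F dF f :
  (forall z, sector gamma z ->
     has_cderiv F (logc z) (cexp (logc z) * dF (logc z))) ->
  (forall z, sector gamma z -> f z = F (logc z)) ->
  holomorphic (sector gamma) f.
Proof.
move=> hF hf z Sz; apply/cvg_ex; exists (dF (logc z)).
apply: (diff_quotient_cvg _ (hF z Sz)); first by case: Sz.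
by apply: filterS (open_sector Sz) => w; exact: hf.
Qed.

End LogChart.

(** * Complex series with geometric bounds *)

Section GeometricSeries.
Context {R : realType}.
Local Notation C := R[i].
Implicit Types (u v : nat -> C) (x y : nat -> R) (K : R).

Lemma series_geometric_le (q K : R) x : 0 <= q < 1 ->
  (forall p, `|x p| <= K * q ^+ p) ->
  cvgn (series x) /\ `|limn (series x)| <= K / (1 - q).
Proof.
move=> /andP[q0 q1] hx.
have h2 : `|q| < 1 by rewrite ger0_norm.
have cg := @cvg_geometric_series R K _ h2.
have cn : cvgn [normed series x].
  apply: (@series_le_cvg _ _ (geometric K q)) => [n|n|n|].
  - exact: normr_ge0.
  - by rewrite /=; apply: le_trans (hx n).
  - exact: hx.
  - by apply/cvg_ex; exists (K * (1 - q)^-1).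
split; first exact: normed_cvg.
apply: le_trans (lim_series_norm cn) _.
rewrite -(cvg_lim _ cg) //.
by apply: lim_series_le => //; apply/cvg_ex; exists (K * (1 - q)^-1).
Qed.

Lemma series_half_le K x : (forall p, `|x p| <= K * 2^-1 ^+ p) ->
  cvgn (series x) /\ `|limn (series x)| <= 2 * K.
Proof.
move=> /series_geometric_le; rewrite (_ : 1 - 2^-1 = 2^-1 :> R); last by lra.
rewrite invrK mulrC; apply; lra.
Qed.

(** Real and imaginary parts are summed separately, which reduces convergence to real series; the
    value is meaningful when both converge, as [geometric_le] ensures. *)
Definition csum u : C :=
  limn (series (fun p => Re (u p))) +i* limn (series (fun p => Im (u p))).

Definition geometric_le K u := forall p, cabs (u p) <= K * 2^-1 ^+ p.

Lemma csum_cvg K u : geometric_le K u ->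
  cvgn (series (fun p => Re (u p))) /\ cvgn (series (fun p => Im (u p))).
Proof.
move=> hu; split; apply: (proj1 (@series_half_le K _ _)) => p.
  exact: le_trans (normr_Re_le _) (hu p).
exact: le_trans (normr_Im_le _) (hu p).
Qed.

Lemma cabs_csum_le K u : geometric_le K u -> cabs (csum u) <= 4 * K.
Proof.
move=> hu; apply: le_trans (cabs_le_ReIm _) _ => /=.
have h1 : `|limn (series (fun p => Re (u p)))| <= 2 * K.
  apply: (proj2 (@series_half_le K _ _)) => p.
  exact: le_trans (normr_Re_le _) (hu p).
have h2 : `|limn (series (fun p => Im (u p)))| <= 2 * K.
  apply: (proj2 (@series_half_le K _ _)) => p.
  exact: le_trans (normr_Im_le _) (hu p).
lra.
Qed.

Lemma csumB K1 K2 u v : geometric_le K1 u -> geometric_le K2 v ->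
  csum (fun p => u p - v p) = csum u - csum v.
Proof.
move=> /csum_cvg[u1 u2] /csum_cvg[v1 v2]; rewrite /csum.
apply/eqP; rewrite eq_complex /= -!lim_seriesB //; apply/andP; split; apply/eqP;
  congr (limn (series _)); apply/funext => p; rewrite !fctE.
  exact: ReB.
exact: ImB.
Qed.

Lemma csumZ K c u : geometric_le K u -> csum (fun p => c * u p) = c * csum u.
Proof.
move=> /csum_cvg[u1 u2]; rewrite /csum; case: c => a b.
apply/eqP; rewrite eq_complex /=.
have Z (r : R) (x : nat -> R) : cvgn (series x) ->
    limn (series (r *: x)) = r * limn (series x).
  by move=> cx; rewrite lim_seriesZ.
rewrite -!Z // -lim_seriesB -?lim_seriesD //; try exact: is_cvg_seriesZ.
apply/andP; split; apply/eqP; congr (limn (series _)); apply/funext => p;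
  rewrite !fctE /GRing.scale /=; by case: (u p).
Qed.

Lemma geometric_leZ K c u : geometric_le K u -> geometric_le (cabs c * K) (fun p => c * u p).
Proof. by move=> h p; rewrite Normc.normcM -mulrA ler_wpM2l ?cabs_ge0. Qed.

(** Serves to write a prescribed boundary value as a series, to be subtracted term by term from the
    Borel-Ritt sum. *)
Lemma csum_single k (c : C) : csum (fun p => if p == k then c else 0) = c.
Proof.
have aux (r : R) : limn (series (fun p => if p == k then r else 0)) = r.
  apply/cvg_lim => //; apply/cvgrPdist_lt => eps eps0; near=> n.
  suff -> : series (fun p => if p == k then r else 0) n = r by rewrite subrr normr0.
  rewrite /series /= (bigD1_seq k) /= ?iota_uniq //; last first.
    by rewrite mem_index_iota /=; near: n; exact: nbhs_infty_gt.
  by rewrite eqxx big1 ?addr0 // => i /negPf ->.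
rewrite /csum; case: c => a b; apply/eqP; rewrite eq_complex /=.
apply/andP; split; apply/eqP; rewrite -[RHS]aux; congr (limn (series _));
  by apply/funext => p; case: ifP.
Unshelve. all: by end_near. Qed.

(** The bounds on second derivatives give each term a quadratic remainder with a geometrically small
    constant on one common disc, and these remainders can be summed. *)
Lemma has_cderiv_csum (F dF d2F : nat -> C -> C) z (K e : R) : 0 < e ->
  (forall p w, cabs (w - z) < e -> has_cderiv (F p) w (dF p w)) ->
  (forall p w, cabs (w - z) < e -> has_cderiv (dF p) w (d2F p w)) ->
  (forall w, cabs (w - z) < e -> geometric_le K (F^~ w)) ->
  (forall w, cabs (w - z) < e -> geometric_le K (dF^~ w)) ->
  (forall w, cabs (w - z) < e -> geometric_le K (d2F^~ w)) ->
  has_cderiv (fun w => csum (F^~ w)) z (csum (dF^~ z)).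
Proof.
move=> e0 h1 h2 g0 g1 g2.
have zz : cabs (z - z) < e by rewrite subrr Normc.normc0.
have K0 : 0 <= K.
  by have := g0 _ zz 0%N; rewrite expr0 mulr1; apply: le_trans; exact: cabs_ge0.
exists (8 * K), e; split => //; first by rewrite mulr_ge0.
move=> h he.
have zh : cabs (z + h - z) < e by rewrite (_ : z + h - z = h) //; ring.
have seg (t : R) : 0 <= t <= 1 -> cabs (z + t%:C * h - z) < e.
  move=> /andP[t0 t1]; rewrite (_ : z + t%:C * h - z = t%:C * h); last by ring.
  rewrite Normc.normcM cabs_real ger0_norm //.
  by apply: le_lt_trans he; rewrite ler_piMl ?cabs_ge0.
have E : csum (F^~ (z + h)) - csum (F^~ z) - csum (dF^~ z) * h =
    csum (fun p => F p (z + h) - F p z - h * dF p z).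
  have gB : geometric_le (2 * K) (fun p => F p (z + h) - F p z).
    move=> p; apply: le_trans (cabsB _ _) _; have := g0 _ zh p; have := g0 _ zz p.
    rewrite -mulrA mulr2n mulrDl mul1r; lra.
  rewrite (csumB gB (geometric_leZ h (g1 _ zz))) (csumB (g0 _ zh) (g0 _ zz)).
  by rewrite (csumZ h (g1 _ zz)) mulrC.
rewrite E.
suff H : geometric_le (2 * K * cabs h ^+ 2) (fun p => F p (z + h) - F p z - h * dF p z).
  by apply: le_trans (cabs_csum_le H) _; rewrite le_eqVlt; apply/orP; left; apply/eqP; ring.
move=> p; rewrite (mulrC h).
have := @cderiv_taylor2 _ (F p) (dF p) (d2F p) z h (K * 2^-1 ^+ p).
have -> : 2 * (K * 2^-1 ^+ p) * cabs h ^+ 2 = 2 * K * cabs h ^+ 2 * 2^-1 ^+ p by ring.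
by apply=> t ht; [apply: h1|apply: h2|apply: g2]; exact: seg.
Qed.

End GeometricSeries.

(** * Weight functions *)

Section WeightFunctionBounds.
Context {R : realType} (omega : R -> R).
Hypothesis homega : W0 omega.

Lemma phi_ge0 (y : R) : 0 <= phi omega y.
Proof. by case: homega => -[_ _ h _ _] _ _ _; apply: h; exact: expR_ge0. Qed.

Lemma phi_nondecreasing : {homo phi omega : x y / x <= y}.
Proof.
case: homega => -[_ h _ _ _] _ _ _ x y xy; apply: h.
- by rewrite in_itv /= expR_ge0.
- by rewrite in_itv /= expR_ge0.
- by rewrite ler_expR.
Qed.

(** This is ln t = o(omega t) read at t = e^y with the constant 1 / (x + 1), where the added 1
    covers x = 0. *)
Lemma phi_superlinear (x : R) : 0 <= x ->
  exists2 T : R, 0 <= T & forall y, T <= y -> x * y <= phi omega y.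
Proof.
move=> x0; case: homega => _ _ /eqoP + _.
have e0 : 0 < (x + 1)^-1 by rewrite invr_gt0 ltr_wpDl.
move=> /(_ _ e0) [M [Mreal HM]].
exists (Num.max 0 (ln (Num.max 1 (M + 1)))); first by rewrite le_max lexx.
move=> y; rewrite ge_max => /andP[y0 yM].
have M1 : 0 < Num.max 1 (M + 1) by rewrite lt_max ltr01.
have : M < expR y.
  apply: (@lt_le_trans _ _ (Num.max 1 (M + 1))).
    by rewrite lt_max ltrDl ltr01 orbT.
  by rewrite -[X in X <= _](@lnK R) ?posrE // ler_expR.
move/HM => /=; rewrite expRK ger0_norm // -[omega _]/(phi omega y).
rewrite (ger0_norm (phi_ge0 y)) mulrC ler_pdivlMr; last by rewrite ltr_wpDl.
by apply: le_trans; rewrite mulrC ler_wpM2l // lerDl.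
Qed.

(** Superlinearity of [phi] bounds the set from above, so that [sup] is a genuine supremum and not a
    default value. *)
Lemma phi_star_ge (x y : R) : 0 <= x -> 0 <= y ->
  x * y - phi omega y <= phi_star omega x.
Proof.
move=> x0 y0; apply: sup_upper_bound; last by exists y.
split; first by exists (x * 0 - phi omega 0); exists 0 => //=.
have [T T0 HT] := phi_superlinear x0.
exists (x * T) => _ [t /= t0 <-].
have [tT|/ltW Tt] := leP t T.
  have := phi_ge0 t; have := ler_wpM2l x0 tT; lra.
have := HT _ Tt; have := mulr_ge0 x0 T0; lra.
Qed.

Lemma phi_star_le (x B : R) :
  (forall y, 0 <= y -> x * y - phi omega y <= B) -> phi_star omega x <= B.
Proof.
move=> hB; apply: ge_sup; first by exists (x * 0 - phi omega 0); exists 0 => /=.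
by move=> _ [y /= y0 <-]; exact: hB.
Qed.

(** On the logarithmic scale [weight_seq omega l] is the conjugate of [l^-1 * phi omega], by
    scaling. This lemma and the next replace [phi_star] in all later estimates. *)
Lemma weight_seq_ge (l y : R) (k : nat) : 0 < l -> 0 <= y ->
  expR (k%:R * y - l^-1 * phi omega y) <= weight_seq omega l k.
Proof.
move=> l0 y0; rewrite /weight_seq ler_expR.
have h := phi_star_ge (mulr_ge0 (ltW l0) (ler0n R k)) y0.
have -> : k%:R * y - l^-1 * phi omega y = l^-1 * (l * k%:R * y - phi omega y).
  by rewrite mulrBr -!mulrA mulKf // gt_eqF.
by rewrite ler_wpM2l // invr_ge0 ltW.
Qed.

Lemma weight_seq_le (l B : R) (k : nat) : 0 < l ->
  (forall y, 0 <= y -> k%:R * y - l^-1 * phi omega y <= B) ->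
  weight_seq omega l k <= expR B.
Proof.
move=> l0 hB; rewrite /weight_seq ler_expR mulrC ler_pdivrMr //.
apply: phi_star_le => y y0; have := hB y y0.
rewrite -(ler_pM2r l0); apply: le_trans.
have -> : (k%:R * y - l^-1 * phi omega y) * l = l * k%:R * y - phi omega y.
  by field; rewrite gt_eqF.
by [].
Qed.

(** Since c >= 0, an element of the supremum above c cannot be the inserted 0, so it comes with a
    constant K; the upper limit then becomes an inequality beyond some T. *)
Lemma growth_index_witness (c : R) : 0 <= c -> (c%:E < growth_index omega)%E ->
  exists g K T : R, [/\ c < g, 1 < K, 0 < T &
    forall t, T <= t -> omega (K `^ g * t) <= K * omega t].
Proof.
move=> c0 /ereal_sup_gt[_ [->|[g /= [g0 [K K1 hK]] <-]]].
  by rewrite lte_fin ltNge c0.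
rewrite lte_fin => cg; exists g, K.
move: hK; rewrite limf_esupE => /ereal_inf_lt[_ [V [M [Mreal HM]] <-]] hsup.
have [T T0 HT] := phi_superlinear (ler01 : 0 <= 1 :> R).
(* Beyond e^(T + 1) one has omega t >= ln t > 0, so the quotient by omega t can be cleared. *)
exists (Num.max (M + 1) (expR (T + 1))); split => //.
  by rewrite lt_max expR_gt0 orbT.
move=> t; rewrite ge_max => /andP[tM tT].
have t0 : 0 < t by apply: lt_le_trans tT; exact: expR_gt0.
have om0 : 0 < omega t.
  have := HT (ln t); rewrite /phi lnK ?posrE // mul1r => h.
  have Tl : T + 1 <= ln t by rewrite -(expRK (T + 1)) ler_ln ?posrE ?expR_gt0.
  have := h _; lra.
have Vt : V t by apply: HM; lra.
have : ((omega (K `^ g * t) / omega t)%:E <= K%:E)%E.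
  apply: le_trans (ltW hsup); apply: ereal_sup_ubound.
  by exists t.
by rewrite lee_fin ler_pdivrMr.
Qed.

(** A shift by [g * ln K] costs a factor K. Iterating u / (g ln K) times, rounded up, costs at most
    K e^(u / g). Arguments below ln T are handled by monotonicity, which accounts for the added
    1. *)
Lemma phi_growth (c : R) : 0 <= c -> (c%:E < growth_index omega)%E ->
  exists g C0 : R, [/\ c < g, 0 < C0 & forall y u, 0 <= y -> 0 <= u ->
    phi omega (y + u) <= C0 * expR (u / g) * (phi omega y + 1)].
Proof.
move=> c0 /(growth_index_witness c0)[g [K [T [cg K1 T0 H]]]].
have g0 : 0 < g by exact: le_lt_trans cg.
have K0 : 0 < K by exact: lt_trans K1.
have lK : 0 < ln K by rewrite ln_gt0.
set A0 := g * ln K; have A00 : 0 < A0 by exact: mulr_gt0.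
have H1 y : ln T <= y -> phi omega (y + A0) <= K * phi omega y.
  move=> Ty; have := H (expR y).
  rewrite -[X in X <= expR y](@lnK R) ?posrE // ler_expR => /(_ Ty).
  by rewrite /powR gt_eqF // -/A0 -expRD addrC.
have Hn n y : ln T <= y -> phi omega (y + n%:R * A0) <= K ^+ n * phi omega y.
  move=> Ty; elim: n => [|n IH]; first by rewrite mul0r addr0 expr0 mul1r.
  rewrite -natr1 mulrDl mul1r addrA exprS -mulrA.
  apply: le_trans (H1 _ _) _; last by rewrite ler_pM2l.
  by rewrite (le_trans Ty) // lerDl mulr_ge0 // ltW.
have Hu y u : ln T <= y -> 0 <= u -> phi omega (y + u) <= K * expR (u / g) * phi omega y.
  move=> Ty u0; set n := (Num.truncn (u / A0)).+1.
  have un : u <= n%:R * A0 by rewrite -ler_pdivrMr //; exact/ltW/truncnS_gt.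
  have nu : (n%:R - 1) * A0 <= u.
    rewrite -natr1 addrK -ler_pdivlMr // truncn_le divr_ge0 //.
    exact: ltW.
  apply: (@le_trans _ _ (phi omega (y + n%:R * A0))).
    by apply: phi_nondecreasing; rewrite lerD2l.
  apply: le_trans (Hn _ _ Ty) _; rewrite ler_wpM2r ?phi_ge0 //.
  rewrite -[X in X ^+ n](@lnK R) ?posrE // -expRM_natl.
  rewrite -[X in _ <= X * _](@lnK R) ?posrE // -expRD ler_expR.
  have : (n%:R - 1) * ln K <= u / g by rewrite ler_pdivlMr // -mulrA (mulrC _ g).
  lra.
set y0 := Num.max 0 (ln T).
exists g, (K * (phi omega y0 + 1)); split => //.
  by rewrite mulr_gt0 // ltr_wpDl // phi_ge0.
move=> y u yge u0.
have p0 := phi_ge0 y; have p1 := phi_ge0 y0.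
have e0 : 0 < expR (u / g) by exact: expR_gt0.
have ke : 0 < K * expR (u / g) by exact: mulr_gt0.
have -> : K * (phi omega y0 + 1) * expR (u / g) * (phi omega y + 1) =
  K * expR (u / g) * ((phi omega y0 + 1) * (phi omega y + 1)) by ring.
have [yT|/ltW Ty] := leP y y0.
  apply: (@le_trans _ _ (phi omega (y0 + u))).
    by apply: phi_nondecreasing; rewrite lerD2r.
  apply: le_trans (Hu _ _ _ u0) _; first by rewrite le_max lexx orbT.
  apply: ler_wpM2l; [exact: ltW|nra].
apply: le_trans (Hu _ _ _ u0) _.
  by apply: le_trans Ty; rewrite le_max lexx orbT.
apply: ler_wpM2l; [exact: ltW|nra].
Qed.

End WeightFunctionBounds.

(** * Regularization of the weight *)

Section ExponentialSmoothing.
Context {R : realType}.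
Implicit Types (u psi : nat -> R) (rho kap : R).

(* The witness is [psi j = \sum_i expR (- rho * i) * u (j + i)]. *)
Lemma exp_smoothing u rho kap C0 : kap < rho -> 0 < C0 ->
  (forall j, 0 <= u j) -> (forall j, u j <= u j.+1) ->
  (forall j i, u (j + i)%N <= C0 * expR (kap * i%:R) * (u j + 1)) ->
  exists psi (L : R), [/\ 0 < L, forall j, psi j = u j + expR (- rho) * psi j.+1,
    forall j, u j <= psi j, forall j, psi j <= psi j.+1 &
    forall j, psi j <= L * (u j + 1)].
Proof.
move=> kr C00 u0 und growth.
(* The growth hypothesis makes the series defining psi geometric of ratio q, and kap < rho makes it
   converge. *)
set q := expR (kap - rho).
have q0 : 0 < q by exact: expR_gt0.
have q1 : q < 1 by rewrite /q expR_lt1 subr_lt0.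
pose x j i := expR (- rho) ^+ i * u (j + i)%N.
have x0 j i : 0 <= x j i by rewrite /x mulr_ge0 // exprn_ge0 // expR_ge0.
have xq j i : `|x j i| <= C0 * (u j + 1) * q ^+ i.
  rewrite ger0_norm // /x /q expRD mulrC exprMn.
  have := growth j i; rewrite expRM_natr => h.
  rewrite mulrA ler_wpM2r ?exprn_ge0 ?expR_ge0 //.
  by apply: le_trans h _; rewrite le_eqVlt; apply/orP; left; apply/eqP; ring.
have q01 : 0 <= q < 1 by rewrite ltW.
have cv j := proj1 (series_geometric_le q01 (xq j)).
have bd j := proj2 (series_geometric_le q01 (xq j)).
pose psi j := limn (series (x j)).
have psiS j : psi j = u j + expR (- rho) * psi j.+1.
  have h1 : series (x j) n.+1 @[n --> \oo] --> psi j by rewrite (cvg_shiftS (series (x j))); exact: cv.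
  have h2 : u j + expR (- rho) * series (x j.+1) n @[n --> \oo] -->
      u j + expR (- rho) * psi j.+1.
    by apply: cvgD; [exact: cvg_cst|apply: cvgM; [exact: cvg_cst|exact: cv]].
  suff E : (fun n => series (x j) n.+1) = (fun n => u j + expR (- rho) * series (x j.+1) n).
    by rewrite E in h1; exact: (cvg_unique _ h1 h2).
  apply/funext => n; rewrite /series /= big_nat_recl // mulr_sumr.
  congr (_ + _); first by rewrite /x expr0 mul1r addn0.
  by apply: eq_bigr => i _; rewrite /x exprS mulrA addnS.
exists psi, (C0 / (1 - q)); split => //.
- by rewrite divr_gt0 // subr_gt0.
- move=> j; rewrite psiS lerDl mulr_ge0 ?expR_ge0 //.
  by apply: limr_ge; [exact: cv|apply: nearW => n; exact: sumr_ge0].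
- move=> j; apply: lim_series_le; [exact: cv|exact: cv|move=> i].
  by rewrite /x ler_wpM2l ?exprn_ge0 ?expR_ge0 // addSn.
- move=> j; apply: le_trans (ler_norm _) _; apply: le_trans (bd j) _.
  by rewrite mulrAC.
Qed.

(** Subtracting the recursion at j from that at j + 1 shows that an increment of psi is a
    nonnegative increment of u plus e^(-rho) times the next increment of psi. The second bound sums
    the resulting geometric growth. *)
Lemma smoothing_increment u psi rho : 0 < rho ->
  (forall j, u j <= u j.+1) -> (forall j, psi j <= psi j.+1) ->
  (forall j, psi j = u j + expR (- rho) * psi j.+1) ->
  (forall j, psi j.+2 - psi j.+1 <= expR rho * (psi j.+1 - psi j)) /\
  forall j m, psi (j + m)%N - psi j <=
    (psi j.+1 - psi j) * expR (rho * m%:R) / (expR rho - 1).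
Proof.
move=> r0 und pnd pS.
have e1 : 1 < expR rho by rewrite expR_gt1.
have D1 j : psi j.+2 - psi j.+1 <= expR rho * (psi j.+1 - psi j).
  have -> : psi j.+1 - psi j =
      (u j.+1 - u j) + expR (- rho) * (psi j.+2 - psi j.+1).
    by rewrite (pS j.+1) (pS j) {1}(pS j.+1); ring.
  rewrite mulrDr mulrA -expRD subrr expR0 mul1r lerDr mulr_ge0 ?expR_ge0 //.
  by rewrite subr_ge0.
split => // j m.
have Dm i : psi (j + i).+1 - psi (j + i)%N <= expR rho ^+ i * (psi j.+1 - psi j).
  elim: i => [|i IH]; first by rewrite addn0 expr0 mul1r.
  rewrite addnS exprS -mulrA; apply: le_trans (D1 _) _.
  by rewrite ler_wpM2l ?expR_ge0.
rewrite expRM_natr ler_pdivlMr ?subr_gt0 //.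
have H : (psi (j + m)%N - psi j) * (expR rho - 1) <=
    (psi j.+1 - psi j) * (expR rho ^+ m - 1).
  elim: m => [|m IH]; first by rewrite addn0 expr0 !subrr mul0r mulr0.
  rewrite addnS exprS; have := Dm m.
  have : 0 < expR rho - 1 by rewrite subr_gt0.
  move: IH; move: (psi (j + m).+1) (psi (j + m)%N) (expR rho ^+ m) => p1 p2 e.
  nra.
apply: le_trans H _; rewrite ler_wpM2l ?subr_ge0 //; lra.
Qed.

(** From J0 on, the function does not exceed its value at 0, so a maximum over a finite range is
    global. *)
Lemma tilted_argmax psi (c : R) : (exists J0, forall j, (J0 <= j)%N -> c * j%:R <= psi j - psi 0%N) ->
  exists J, forall j, c * j%:R - psi j <= c * J%:R - psi J.
Proof.
move=> [J0 hJ].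
pose f (i : 'I_J0.+1) := c * i%:R - psi i.
have [i _ hi] := @arg_maxP _ _ _ ord0 xpredT f isT.
exists i => j; have [jJ|Jj] := leqP J0 j; last first.
  by have := hi (Ordinal (leqW Jj)) isT.
have := hi ord0 isT; rewrite /f /= mulr0 sub0r; apply: le_trans.
have := hJ _ jJ; lra.
Qed.

End ExponentialSmoothing.

(** With t n a threshold for Q n, let nu p be the largest n <= p with t n <= p; the empty maximum
    gives the exceptional value 0. *)
Lemma eventually_diagonal (Q : nat -> nat -> Prop) :
  (forall n, exists t, forall p, (t <= p)%N -> Q n p) ->
  exists nu : nat -> nat, (forall p, nu p = 0%N \/ Q (nu p) p) /\
    forall N, exists p0, forall p, (p0 <= p)%N -> (N <= nu p)%N.
Proof.
move=> /choice[t ht].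
exists (fun p => \max_(n < p.+1 | (t n <= p)%N) n); split => [p|N].
  have [n0 hn0|no] := pickP (fun n : 'I_p.+1 => (t n <= p)%N); last first.
    by left; rewrite big_pred0.
  right; have [|i hi ->] := eq_bigmax_cond (A := fun n : 'I_p.+1 => (t n <= p)%N) (@nat_of_ord _).
    by apply/card_gt0P; exists n0.
  exact: ht.
exists (maxn N (t N)) => p; rewrite geq_max => /andP[Np tp].
by apply: (leq_bigmax_cond (Ordinal (Np : (N < p.+1)%N))).
Qed.

(** * Tilting with slowly growing multipliers *)

Section WeightInterpolation.
Context {R : realType}.
Local Notation C := R[i].

(** For fixed n let J maximize p j - (n + 1) psi j. Lowering n + 1 to n frees one psi J, which
    absorbs the constant c_n once p is large, because J tends to infinity with p. A diagonal choice
    of n then leaves a single constant. *)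
Lemma slow_tilting (psi alpha : nat -> R) (rho : R) :
  (forall j, 0 <= psi j) -> (forall j, psi j <= psi j.+1) ->
  (forall j, psi j.+2 - psi j.+1 <= expR rho * (psi j.+1 - psi j)) ->
  (forall c, 0 <= c -> exists J, forall j, (J <= j)%N -> c * j%:R <= psi j) ->
  (forall n, exists2 c, 0 <= c & forall p B,
     (forall j, p%:R * j%:R - n.+1%:R * psi j <= B) -> alpha p <= expR (c + p%:R + B)) ->
  exists (j_ n_ : nat -> nat) (c : R), [/\
    forall p, alpha p <= expR (c + p%:R + p%:R * (j_ p)%:R - (n_ p)%:R * psi (j_ p)),
    forall p, (n_ p)%:R * (psi (j_ p).+1 - psi (j_ p)) <= expR rho * p%:R &
    forall N, exists p0, forall p, (p0 <= p)%N -> (N <= n_ p)%N].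
Proof.
move=> psi0 pnd pD pinf halpha.
have pmono i j : (i <= j)%N -> psi i <= psi j.
  by move=> ij; apply: (homo_leq (@le_refl _ _) (@le_trans _ _) pnd).
have exJ np : exists J, forall j,
    np.2%:R * j%:R - np.1.+1%:R * psi j <= np.2%:R * J%:R - np.1.+1%:R * psi J.
  case: np => n p /=.
  have [|J hJ] := @tilted_argmax _ psi (p%:R / n.+1%:R).
    have [|J0 hJ0] := pinf (p%:R / n.+1%:R + `|psi 0%N|).
      by rewrite addr_ge0 // divr_ge0.
    exists J0.+1 => j jJ; have := hJ0 _ (ltnW jJ); rewrite mulrDl.
    move: (p%:R / n.+1%:R * j%:R) => cj.
    have j1 : 1 <= j%:R :> R by rewrite ler1n (leq_ltn_trans _ jJ).
    have := ler_peMr (normr_ge0 (psi 0%N)) j1; have := ler_norm (psi 0%N); lra.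
  exists J => j; have := hJ j.
  have n0 : 0 < n.+1%:R :> R by rewrite ltr0n.
  have E (N q x y : R) : N != 0 -> N * (q / N * x - y) = q * x - N * y.
    by move=> N0; field.
  by rewrite -(ler_pM2l n0) !E ?gt_eqF.
have [J_ hJ] := choice exJ.
have exc n : exists c, 0 <= c /\ forall p B,
    (forall j, p%:R * j%:R - n.+1%:R * psi j <= B) -> alpha p <= expR (c + p%:R + B).
  by have [c c0 h] := halpha n; exists c.
have [c_ hc] := choice exc.
(* If J stayed below B, passing to J + 1 would gain p and lose at most (n + 1) (psi B - psi 0),
   against maximality for large p. *)
have Jinf n B : exists p0, forall p, (p0 <= p)%N -> (B <= J_ (n, p))%N.
  exists (Num.truncn (n.+1%:R * (psi B - psi 0%N))).+1 => p hp; rewrite leqNgt; apply/negP => JB.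
  have := hJ (n, p) (J_ (n, p)).+1; rewrite /= -natr1 mulrDr mulr1.
  have h1 := pmono _ _ JB; have h2 := pmono _ _ (leq0n (J_ (n, p))).
  have h3 : n.+1%:R * (psi B - psi 0%N) < p%:R.
    by apply: lt_le_trans (truncnS_gt _) _; rewrite ler_nat.
  have n0 : 0 < n.+1%:R :> R by rewrite ltr0n.
  nra.
have [|nu [hnu nuinf]] := @eventually_diagonal (fun n p => (0 < J_ (n, p))%N /\ c_ n <= psi (J_ (n, p))).
  move=> n; have [Jc hJc] := pinf _ (proj1 (hc n)).
  have [p0 hp0] := Jinf n (maxn Jc 1).
  exists p0 => p /hp0; rewrite geq_max => /andP[h1 h2]; split => //.
  apply: le_trans (hJc _ h1); rewrite ler_peMr ?(proj1 (hc n)) //.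
  by rewrite ler1n.
exists (fun p => J_ (nu p, p)), nu, (c_ 0%N); split => // p.
  have [h0 h1] := hc (nu p).
  apply: le_trans (h1 p _ (hJ (nu p, p))) _; rewrite ler_expR /=.
  case: (hnu p) => [->|[_ hQ]]; first by have := psi0 (J_ (0%N, p)); rewrite mul1r mul0r; lra.
  by have := proj1 (hc 0%N); rewrite -natr1 mulrDl mul1r; lra.
case: (hnu p) => [->|[J0 _]]; first by rewrite mul0r mulr_ge0 ?expR_ge0.
(* Maximality against the predecessor bounds the increment before J; the increment after J is larger
   by at most e^rho. *)
have := hJ (nu p, p) (J_ (nu p, p)).-1; rewrite /=.
move: J0; case: (J_ (nu p, p)) => // j _ /=.
rewrite -[j.+1%:R]natr1 mulrDr mulr1 => h.
have h2 : (nu p).+1%:R * (psi j.+1 - psi j) <= p%:R by rewrite mulrBr; lra.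
have n0 : 0 <= (nu p)%:R :> R by [].
apply: (@le_trans _ _ ((nu p).+1%:R * (psi j.+2 - psi j.+1))).
  by rewrite ler_wpM2r ?subr_ge0 // ler_nat.
apply: (@le_trans _ _ ((nu p).+1%:R * (expR rho * (psi j.+1 - psi j)))).
  by rewrite ler_wpM2l.
by rewrite mulrCA ler_wpM2l ?expR_ge0.
Qed.

(** Once t >= c / (1 - th), the quotient e^((1 - th) t) exceeds c; for smaller t the left side is
    bounded. *)
Lemma sublinear_exp (c th : R) : 0 <= c -> th < 1 ->
  exists2 K, 0 <= K & forall t, 0 <= t -> c * expR (th * t) <= expR t + K.
Proof.
move=> c0 th1.
have d0 : 0 < 1 - th by rewrite subr_gt0.
set t0 := c / (1 - th).
have t00 : 0 <= t0 by rewrite divr_ge0 // ltW.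
exists (c * expR (`|th| * t0)); first by rewrite mulr_ge0 ?expR_ge0.
move=> t t0'; have [tt|/ltW tt] := leP t t0.
  apply: (@le_trans _ _ (c * expR (`|th| * t0))); last by rewrite lerDr expR_ge0.
  rewrite ler_wpM2l // ler_expR; have := ler_norm th; have := normr_ge0 th; nra.
apply: (@le_trans _ _ (expR t)); last by rewrite lerDl mulr_ge0 ?expR_ge0.
rewrite -[X in _ <= expR X](subrK (th * t)) expRD ler_wpM2r ?expR_ge0 //.
have : c <= (1 - th) * t by rewrite mulrC -ler_pdivrMr.
have := expR_ge1Dx (t - th * t); lra.
Qed.

Lemma uniform_finite (P : nat -> R -> Prop) (N : nat) :
  (forall p K K', K <= K' -> P p K -> P p K') ->
  (forall p, exists K, P p K) -> exists K, forall p, (p < N)%N -> P p K.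
Proof.
move=> mono ex; elim: N => [|N [K hK]]; first by exists 0.
have [K' hK'] := ex N; exists (Num.max K K') => p; rewrite ltnS leq_eqVlt => /orP[/eqP->|pN].
  by apply: mono hK'; rewrite le_max lexx orbT.
by apply: mono (hK _ pN); rewrite le_max lexx.
Qed.

End WeightInterpolation.

(** * Choice of the nodes *)

Section NodeSelection.
Context {R : realType} (omega : R -> R).
Hypothesis homega : W0 omega.
Local Notation C := R[i].
Local Notation u_ := (fun j : nat => phi omega j%:R).

(** Membership is used at l = 1 / ((n + 1) L), so that phi / l dominates (n + 1) psi up to a
    constant. Rounding the conjugate variable down to an integer costs the extra [p%:R]. *)
Lemma Lambda_conjugate_bound (psi : nat -> R) (L : R) (a : nat -> C) : 0 < L ->
  (forall j, psi j <= L * (phi omega j%:R + 1)) -> Lambda_Beurling omega a ->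
  forall n, exists2 c : R, 0 <= c & forall p B,
    (forall j, p%:R * j%:R - n.+1%:R * psi j <= B) -> cabs (a p) <= expR (c + p%:R + B).
Proof.
move=> L0 psiL ha n.
have N0 : 0 < n.+1%:R * L by rewrite mulr_gt0.
have l0 : 0 < (n.+1%:R * L)^-1 by rewrite invr_gt0.
have [M HM] := ha _ l0.
have M1 : 0 < Num.max 1 M by rewrite lt_max ltr01.
exists (ln (Num.max 1 M) + n.+1%:R * L) => [|p B hB].
  by rewrite addr_ge0 ?(ltW N0) // ln_ge0 // le_max lexx.
have W0' : 0 < weight_seq omega (n.+1%:R * L)^-1 p by exact: expR_gt0.
have aM : cabs (a p) <= Num.max 1 M * weight_seq omega (n.+1%:R * L)^-1 p.
  rewrite -ler_pdivrMr // le_max; apply/orP; right; apply: HM.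
  by exists p.
apply: le_trans aM _; rewrite -addrA -addrA expRD lnK ?posrE //.
rewrite ler_pM2l //; apply: weight_seq_le => // y y0; rewrite invrK.
set j := Num.truncn y.
have /andP[jy yj] := truncn_itv y0; rewrite -/j in jy yj.
have h1 := hB j; have h2 := psiL j.
have h3 : phi omega j%:R <= phi omega y by exact: (phi_nondecreasing homega).
have h4 : p%:R * y <= p%:R * (j%:R + 1) by rewrite ler_wpM2l // natr1 ltW.
have n0 : 0 <= n.+1%:R :> R by [].
have h5 : n.+1%:R * psi j <= n.+1%:R * (L * (phi omega j%:R + 1)) by rewrite ler_wpM2l.
have h6 : n.+1%:R * L * phi omega j%:R <= n.+1%:R * L * phi omega y.
  by rewrite ler_wpM2l // ltW.
move: h1 h2 h4 h5 h6; rewrite !mulrDr !mulr1 !mulrA.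
move: (n.+1%:R * L * phi omega j%:R) (n.+1%:R * L * phi omega y) (n.+1%:R * psi j)
  (p%:R * y) (p%:R * j%:R) (n.+1%:R * L) => x1 x2 x3 x4 x5 x6; lra.
Qed.

(** Measures how far the order k of differentiation exceeds the index p; its logarithm governs the
    shift of the maximizer below. *)
Definition node_ratio (p k : nat) : R := Num.max 1 (k%:R / p.+1%:R).

Lemma node_ratio_ge1 p k : 1 <= node_ratio p k.
Proof. by rewrite le_max lexx. Qed.

Lemma node_ratio_le p k : node_ratio p k <= k%:R + 1.
Proof.
rewrite ge_max; apply/andP; split; first by rewrite lerDr.
rewrite ler_pdivrMr ?ltr0n // -natr1.
have : 0 <= k%:R :> R by []. have : 0 <= p%:R :> R by []. nra.
Qed.

Lemma node_ratioM_le p k : node_ratio p k * p.+1%:R <= p.+1%:R + k%:R.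
Proof.
rewrite /node_ratio; have [h|h] := leP 1 (k%:R / p.+1%:R : R).
  by rewrite divfK ?pnatr_eq0 // lerDr.
by rewrite mul1r lerDl.
Qed.

(** The weight is bounded below by testing the conjugate at j_p + m + D + 1, with m close to (1 + b)
    ln [node_ratio p k]. The term k m produces the logarithmic factor, and the remaining errors are
    linear in p and k. *)
Lemma node_selection (b A : R) (a : nat -> C) : 0 < b -> 0 <= A ->
  ((1 + b)%:E < growth_index omega)%E -> Lambda_Beurling omega a ->
  exists y : nat -> R, forall l, 0 < l -> exists2 K : R, 0 < K & forall p k : nat,
    cabs (a p) * expR (y p * (k%:R - p%:R) + (1 + b) * k%:R * ln (node_ratio p k)
      + A * (p%:R + k%:R)) <= K * 4^-1 ^+ p * weight_seq omega l k.
Proof.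
move=> b0 A0 hb ha.
have b1 : 0 < 1 + b by rewrite ltr_wpDl.
have [g [C0 [bg C00 growth]]] := phi_growth homega (ltW b1) hb.
have g0 : 0 < g by exact: lt_trans bg.
pose rho := (1 + b)^-1; pose kap := g^-1.
have r0 : 0 < rho by rewrite invr_gt0.
have k0 : 0 < kap by rewrite invr_gt0.
have kr : kap < rho by rewrite /kap /rho ltf_pV2.
have und j : phi omega j%:R <= phi omega j.+1%:R.
  by apply: (phi_nondecreasing homega); rewrite ler_nat.
have ug j i : phi omega (j + i)%:R <= C0 * expR (kap * i%:R) * (phi omega j%:R + 1).
  by rewrite natrD (mulrC kap); apply: growth.
have [psi [L [L0 psiS upsi pnd psiL]]] :=
  @exp_smoothing R u_ rho kap C0 kr C00 (fun j => phi_ge0 homega j%:R) und ug.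
have [pD pDm] := smoothing_increment r0 und pnd psiS.
have psi0 j : 0 <= psi j by apply: le_trans (upsi j); exact: phi_ge0.
have pinf c : 0 <= c -> exists J, forall j, (J <= j)%N -> c * j%:R <= psi j.
  move=> c0; have [T T0 HT] := phi_superlinear homega c0.
  exists (Num.truncn T).+1 => j hj; apply: le_trans (upsi j); apply: HT.
  by apply: le_trans (ltW (truncnS_gt T)) _; rewrite ler_nat.
have [j_ [n_ [c [haj hnD ninf]]]] := slow_tilting psi0 pnd pD pinf
  (Lambda_conjugate_bound L0 psiL ha).
(* One e^rho comes from the increment bound at j_p, one from rounding m up, and the denominator from
   summing geometric increments. *)
pose C2 := expR rho * expR rho / (expR rho - 1).
have er1 : 0 < expR rho - 1 by rewrite subr_gt0 expR_gt1.
have C20 : 0 <= C2 by rewrite divr_ge0 ?mulr_ge0 ?expR_ge0 // ltW.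
(* [B] pays for the errors linear in p and leaves e^(-2 p) <= 4^(-p); [D] pays for those linear in
   k, including the one caused by [B]. *)
pose B := C2 * expR rho + A + 3.
pose D := (Num.truncn (C2 * expR rho + A + B)).+1.
(* As rho (1 + b) = 1, the factor e^(rho m) is comparable with the ratio itself. *)
pose m p k := (Num.truncn ((1 + b) * ln (node_ratio p k))).+1.
have lnr p k : 0 <= ln (node_ratio p k) by rewrite ln_ge0 // node_ratio_ge1.
have m1 p k : (1 + b) * ln (node_ratio p k) <= (m p k)%:R by exact/ltW/truncnS_gt.
have m2 p k : (m p k)%:R <= (1 + b) * ln (node_ratio p k) + 1.
  by rewrite -natr1 lerD2r truncn_le mulr_ge0 // ltW.
have em th p k : 0 <= th -> expR (th * (m p k)%:R) <= expR th * expR (th * (1 + b) * ln (node_ratio p k)).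
  move=> th0; rewrite -expRD ler_expR -mulrA.
  have := ler_wpM2l th0 (m2 p k); lra.
have shifted p k : (n_ p)%:R * psi (j_ p + m p k)%N <=
    (n_ p)%:R * psi (j_ p) + C2 * expR rho * (p%:R + k%:R + 1).
  have erm : expR (rho * (m p k)%:R) <= expR rho * node_ratio p k.
    apply: le_trans (em _ p k (ltW r0)) _.
    rewrite mulVf ?gt_eqF // mul1r lnK // posrE.
    exact: lt_le_trans (node_ratio_ge1 p k).
  have h := pDm (j_ p) (m p k).
  have h1 : psi (j_ p + m p k)%N - psi (j_ p) <=
      (psi (j_ p).+1 - psi (j_ p)) * (expR rho * node_ratio p k) / (expR rho - 1).
    apply: le_trans h _; rewrite ler_pM2r ?invr_gt0 // ler_wpM2l // subr_ge0.
    exact: pnd.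
  have n0 : 0 <= (n_ p)%:R :> R by [].
  have h2 := ler_wpM2l n0 h1.
  have h3 : (n_ p)%:R * ((psi (j_ p).+1 - psi (j_ p)) * (expR rho * node_ratio p k) / (expR rho - 1))
     <= expR rho * p%:R * (expR rho * node_ratio p k) / (expR rho - 1).
    rewrite !mulrA ler_pM2r ?invr_gt0 // -mulrA -[X in _ <= X]mulrA.
    apply: ler_wpM2r; last exact: hnD.
    by rewrite mulr_ge0 ?expR_ge0 // (le_trans ler01) // node_ratio_ge1.
  have h4 : expR rho * p%:R * (expR rho * node_ratio p k) / (expR rho - 1) <=
      C2 * (p%:R + k%:R + 1).
    have -> : expR rho * p%:R * (expR rho * node_ratio p k) / (expR rho - 1) =
       C2 * (node_ratio p k * p%:R) by rewrite /C2; field; rewrite gt_eqF.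
    rewrite ler_wpM2l //; have := node_ratioM_le p k; rewrite -natr1.
    have := node_ratio_ge1 p k; lra.
  have h5 : C2 * (p%:R + k%:R + 1) <= C2 * expR rho * (p%:R + k%:R + 1).
    rewrite ler_wpM2r ?addr_ge0 // ler_peMr //; have := expR_gt1 rho; rewrite r0 => /ltW; lra.
  move: h2 h3 h4 h5; rewrite mulrBr; lra.
exists (fun p => (j_ p)%:R + B) => l l0.
have l0' : 0 < l^-1 by rewrite invr_gt0.
pose E := C0 * expR (kap * (D.+1)%:R).
have E0 : 0 < E by rewrite mulr_gt0 ?expR_gt0.
have phiY i : phi omega (i + D.+1)%:R <= E * (psi i + 1).
  apply: le_trans (ug i D.+1) _; rewrite ler_pM2l //; have := upsi i; lra.
clearbody E.
have key : exists K, forall p k, k%:R * (j_ p + m p k + D)%:R - (n_ p)%:R * psi (j_ p + m p k)%N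
    <= K + l^-1 * phi_star omega (l * k%:R).
  (* Testing one unit beyond [D] leaves a spare k, which absorbs phi / l in the case of small p. *)
  have wge p k : k%:R * (j_ p + m p k + D.+1)%:R - l^-1 * phi omega (j_ p + m p k + D.+1)%:R
      <= l^-1 * phi_star omega (l * k%:R).
    by rewrite -ler_expR; apply: weight_seq_ge.
  (* For the finitely many p with n_ p < E / l, the bound kap * (1 + b) < 1 makes
     the last term of [wge] sublinear in k. *)
  have [p1 hp1] := ninf (Num.truncn (l^-1 * E)).+1.
  have [||K1 hK1] := @uniform_finite R (fun p K => forall k, k%:R * (j_ p + m p k + D)%:R
      - (n_ p)%:R * psi (j_ p + m p k)%N <= K + l^-1 * phi_star omega (l * k%:R)) p1.
  - by move=> p K K' KK' h k; apply: le_trans (h k) _; rewrite lerD2r.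
  - move=> p; pose c1 := l^-1 * (C0 * expR (kap * (j_ p + D.+1)%:R) * (phi omega 0 + 1)) * expR kap.
    have c10 : 0 <= c1.
      by rewrite /c1 !mulr_ge0 ?expR_ge0 ?(ltW l0') ?(ltW C00) // addr_ge0 // phi_ge0.
    have th1 : kap * (1 + b) < 1 by rewrite -ltr_pdivlMr // div1r.
    have [K K0 hK] := sublinear_exp c10 th1.
    exists (K + 1) => k.
    have h1 : l^-1 * phi omega (j_ p + m p k + D.+1)%:R <= k%:R + 1 + K.
      have := ug 0%N (j_ p + m p k + D.+1)%N; rewrite add0n => h.
      apply: le_trans (ler_wpM2l (ltW l0') h) _.
      have := hK _ (lnr p k); rewrite lnK ?posrE; last first.
        exact: lt_le_trans (node_ratio_ge1 p k).
      move=> h2; apply: (@le_trans _ _ (node_ratio p k + K)); last first.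
        by rewrite lerD2r node_ratio_le.
      apply: le_trans h2.
      have hm : expR (kap * (j_ p + m p k + D.+1)%:R) <= expR (kap * (j_ p + D.+1)%:R) *
          (expR kap * expR (kap * (1 + b) * ln (node_ratio p k))).
        rewrite addnAC natrD mulrDr expRD ler_pM2l ?expR_gt0 //.
        exact: em (ltW k0).
      have -> : c1 * expR (kap * (1 + b) * ln (node_ratio p k)) =
        l^-1 * (C0 * (expR (kap * (j_ p + D.+1)%:R) *
          (expR kap * expR (kap * (1 + b) * ln (node_ratio p k)))) * (phi omega 0 + 1)).
        by rewrite /c1; ring.
      rewrite ler_pM2l // ler_wpM2r ?addr_ge0 ?(phi_ge0 homega) //.
      by rewrite ler_pM2l.
    have := wge p k; have : 0 <= (n_ p)%:R * psi (j_ p + m p k)%N by exact: mulr_ge0.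
    move: h1; rewrite addnS -natr1 mulrDr mulr1; lra.
  exists (Num.max K1 (l^-1 * E)) => p k.
  have [pp|pp] := ltnP p p1.
    by apply: le_trans (hK1 _ pp k) _; rewrite lerD2r le_max lexx.
  (* For large p the multiplier [n_ p] exceeds E / l, so n_p psi dominates phi / l at the test point
     up to a constant. *)
  have hn : l^-1 * E <= (n_ p)%:R.
    by apply: le_trans (ltW (truncnS_gt _)) _; rewrite ler_nat hp1.
  have h1 := ler_wpM2l (ltW l0') (phiY (j_ p + m p k)%N).
  have h2 := ler_wpM2r (psi0 (j_ p + m p k)%N) hn.
  have h3 := wge p k.
  have h4 : l^-1 * E <= Num.max K1 (l^-1 * E) by rewrite le_max lexx orbT.
  have kk : 0 <= k%:R :> R by [].
  move: h1 h2 h3; rewrite addnS -natr1 !mulrDr !mulr1; lra.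
have [K hK] := key.
exists (expR (c + C2 * expR rho + K)); first exact: expR_gt0.
move=> p k.
have e4 : expR (- (2 * p%:R)) <= 4^-1 ^+ p :> R.
  rewrite mulrC -mulrN expRM_natl lerXn2r ?nnegrE ?expR_ge0 //.
  rewrite expRN lef_pV2 ?posrE ?expR_gt0 //.
  have -> : 2 = 1 + 1 :> R by [].
  rewrite expRD; have := expR_ge1Dx (1 : R); nra.
rewrite /weight_seq.
apply: (@le_trans _ _ (expR (c + C2 * expR rho + K) * expR (- (2 * p%:R)) *
    expR (l^-1 * phi_star omega (l * k%:R)))); last first.
  by rewrite ler_pM2r ?expR_gt0 // ler_pM2l ?expR_gt0.
apply: le_trans (ler_wpM2r (expR_ge0 _) (haj p)) _.
rewrite -!expRD ler_expR.
have h1 := shifted p k; have h2 := hK p k.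
have kk : 0 <= k%:R :> R by [].
have h3 := ler_wpM2l kk (m1 p k).
have hD : C2 * expR rho + A + B <= D%:R by exact/ltW/truncnS_gt.
have h4 := ler_wpM2l kk hD.
have EB : C2 * expR rho + A + 1 - B = - 2 by rewrite /B; ring.
have h5 : (C2 * expR rho + A + 1 - B) * p%:R = - (2 * p%:R) by rewrite EB mulNr.
clearbody B D m C2.
move: h1 h2 h3 h4 h5; rewrite !natrD.
move: (C2 * expR rho) (psi _) (psi _) (ln _) (l^-1 * _) => X Y Z t w.
lra.
Qed.

End NodeSelection.

(** * The truncated exponential *)

Section GammaKernel.
Context {R : realType}.
Local Notation C := R[i].
Implicit Types (F G : C -> C) (z s : C) (g : nat -> C).

Lemma has_cderivM F G z d1 d2 : has_cderiv F z d1 -> has_cderiv G z d2 ->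
  has_cderiv (fun w => F w * G w) z (d1 * G z + F z * d2).
Proof.
move=> [M1 [e1 [M10 e10 h1]]] [M2 [e2 [M20 e20 h2]]].
pose A := cabs d1 + M1 * e1.
exists (cabs (F z) * M2 + cabs (G z) * M1 + A * (cabs d2 + M2 * e2)), (Num.min e1 e2); split.
- by rewrite !addr_ge0 ?mulr_ge0 ?addr_ge0 ?mulr_ge0 ?cabs_ge0 // ltW.
- by rewrite lt_min e10.
move=> h; rewrite lt_min => /andP[he1 he2].
have := h1 _ he1; have := h2 _ he2.
set k1 := F (z + h) - F z; set k2 := G (z + h) - G z => H2 H1.
have h0 := cabs_ge0 h.
have lip k d M e : 0 <= M -> cabs h < e -> cabs (k - d * h) <= M * cabs h ^+ 2 ->
    cabs k <= (cabs d + M * e) * cabs h.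
  move=> M0 he H; rewrite (_ : k = (k - d * h) + d * h); last by ring.
  apply: le_trans (cabsD _ _) _; rewrite Normc.normcM.
  have : M * cabs h ^+ 2 <= M * e * cabs h.
    by rewrite expr2 mulrA ler_wpM2r // ler_wpM2l // ltW.
  lra.
have L1 := lip _ _ _ _ M10 he1 H1; have L2 := lip _ _ _ _ M20 he2 H2.
rewrite (_ : _ - _ = F z * (k2 - d2 * h) + G z * (k1 - d1 * h) + k1 * k2); last first.
  by rewrite /k1 /k2; ring.
clearbody k1 k2.
apply: le_trans (cabsD _ _) _; rewrite mulrDl; apply: lerD.
  apply: le_trans (cabsD _ _) _; rewrite mulrDl !Normc.normcM -!mulrA.
  by apply: lerD; apply: ler_wpM2l => //; exact: cabs_ge0.
rewrite Normc.normcM expr2 mulrACA; apply: ler_pM => //; exact: cabs_ge0.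
Qed.

Lemma has_cderiv_comp F G z d1 d2 : has_cderiv G z d1 -> has_cderiv F (G z) d2 ->
  has_cderiv (fun w => F (G w)) z (d2 * d1).
Proof.
move=> [M1 [e1 [M10 e10 h1]]] [M2 [e2 [M20 e20 h2]]].
pose A := cabs d1 + M1 * e1 + 1.
have A0 : 0 < A by rewrite ltr_wpDl // addr_ge0 ?cabs_ge0 // mulr_ge0 // ltW.
exists (cabs d2 * M1 + M2 * A ^+ 2), (Num.min e1 (e2 / A)); split.
- by rewrite addr_ge0 // mulr_ge0 ?cabs_ge0 ?sqr_ge0.
- by rewrite lt_min e10 divr_gt0.
move=> h; rewrite lt_min => /andP[he1 he2].
have := h1 _ he1; set k := G (z + h) - G z => H1.
have h0 := cabs_ge0 h.
have L1 : cabs k <= A * cabs h.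
  rewrite (_ : k = (k - d1 * h) + d1 * h); last by ring.
  apply: le_trans (cabsD _ _) _; rewrite Normc.normcM /A.
  have : M1 * cabs h ^+ 2 <= M1 * e1 * cabs h.
    by rewrite expr2 mulrA ler_wpM2r // ler_wpM2l // ltW.
  lra.
have ke : cabs k < e2.
  by apply: le_lt_trans L1 _; rewrite mulrC -ltr_pdivlMr.
have := h2 _ ke; rewrite (_ : G z + k = G (z + h)); last by rewrite /k; ring.
move=> H2.
rewrite (_ : _ - _ = d2 * (k - d1 * h) + (F (G (z + h)) - F (G z) - d2 * k)); last by ring.
apply: le_trans (cabsD _ _) _; rewrite mulrDl Normc.normcM -!mulrA; apply: lerD.
  by rewrite ler_wpM2l ?cabs_ge0.
apply: le_trans H2 _; rewrite ler_wpM2l // mulrA -expr2.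
by rewrite -exprMn lerXn2r // nnegrE ?cabs_ge0 // mulr_ge0 // ltW.
Qed.

Lemma has_cderivX n z : has_cderiv (fun w => w ^+ n) z (n%:R * z ^+ n.-1).
Proof.
elim: n => [|n IH]; first by rewrite mul0r; exact: has_cderiv_cst.
have id1 : has_cderiv (fun w => w) z 1.
  have := has_cderiv_lin 1 z; rewrite (_ : (fun w => 1 * w) = id) //.
  by apply/funext => w; rewrite mul1r.
have := has_cderivM id1 IH; rewrite (_ : (fun w => w * w ^+ n) = (fun w => w ^+ n.+1)).
  move/has_cderiv_eq; apply; rewrite -natr1 /= mul1r.
  by case: n {IH} => [|n]; rewrite ?mul0r ?mulr0 ?addr0 ?add0r ?mul1r //= exprS; ring.
by apply/funext => w; rewrite exprS.
Qed.

(* The Poisson weights; [gtail N s] is the probability that a Poisson variable of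
   parameter [s] is at least [N], i.e. the regularized incomplete gamma function. *)
Definition poisson_term (i : nat) s : C := cexp (- s) * (s ^+ i / i`!%:R).
Definition gtail (N : nat) s : C := 1 - \sum_(i < N) poisson_term i s.

Lemma factC_neq0 n : (n`!%:R : C) != 0.
Proof. by rewrite pnatr_eq0 -lt0n fact_gt0. Qed.

Lemma gtailS N s : gtail N.+1 s = gtail N s - poisson_term N s.
Proof. by rewrite /gtail big_ord_recr /=; ring. Qed.

Lemma poisson_termS N s :
  s * poisson_term N s = N.+1%:R * poisson_term N.+1 s.
Proof.
rewrite /poisson_term exprS factS natrM; field.
by rewrite factC_neq0 addrC natr1 pnatr_eq0.
Qed.

Lemma has_cderiv_poisson_term i s : has_cderiv (poisson_term i) s
  ((if i is j.+1 then poisson_term j s else 0) - poisson_term i s).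
Proof.
have e1 : has_cderiv (fun w => cexp (- w)) s (- cexp (- s)).
  have := has_cderiv_exp (has_cderiv_lin (-1) s).
  rewrite (_ : (fun w => cexp (-1 * w)) = (fun w => cexp (- w))); last first.
    by apply/funext => w; rewrite mulN1r.
  by move/has_cderiv_eq; apply; rewrite mulrN1 mulN1r.
have e2 : has_cderiv (fun w => w ^+ i / i`!%:R) s (i%:R * s ^+ i.-1 / i`!%:R).
  have := has_cderivZ (i`!%:R^-1) (has_cderivX i s).
  rewrite (_ : (fun w => _) = (fun w => w ^+ i / i`!%:R)); last first.
    by apply/funext => w; rewrite mulrC.
  by move/has_cderiv_eq; apply; rewrite mulrC.
apply: has_cderiv_eq (has_cderivM e1 e2) _; rewrite /poisson_term.
case: i {e2} => [|j]; first by rewrite !mul0r mulr0; ring.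
rewrite factS natrM /=; field.
by rewrite factC_neq0 addrC natr1 pnatr_eq0.
Qed.

Lemma has_cderiv_gtail N s : has_cderiv (gtail N.+1) s (poisson_term N s).
Proof.
elim: N => [|N IH].
  have := has_cderivD (has_cderiv_cst 1 s) (has_cderivZ (-1) (has_cderiv_poisson_term 0 s)).
  rewrite (_ : (fun w => _) = gtail 1); last first.
    by apply/funext => w; rewrite /gtail big_ord1; ring.
  by move/has_cderiv_eq; apply; ring.
have := has_cderivD IH (has_cderivZ (-1) (has_cderiv_poisson_term N.+1 s)).
rewrite (_ : (fun w => _) = gtail N.+2); last first.
  by apply/funext => w; rewrite [gtail N.+2 w]gtailS; ring.
by move/has_cderiv_eq; apply; ring.
Qed.

Lemma cabs_poisson_term i s :
  cabs (poisson_term i s) = expR (- Re s) * (cabs s ^+ i / i`!%:R).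
Proof.
rewrite /poisson_term Normc.normcM cabs_cexp Normc.normcM Normc.normcV cabsX cabs_nat.
by case: s.
Qed.

(** The tail vanishes at 0, and on the segment to s its derivative is at most (t |s|)^N / N!, as
    e^(-t s) has modulus at most 1; integration over t gives the claim. *)
Lemma cabs_gtail_small N s : 0 <= Re s ->
  cabs (gtail N.+1 s) <= 2 * (cabs s ^+ N.+1 / N.+1`!%:R).
Proof.
move=> s0.
have G0 : gtail N.+1 0 = 0 :> C.
  rewrite /gtail big_ord_recl big1 => [|i _]; last first.
    by rewrite /poisson_term /= exprS !mul0r mulr0.
  by rewrite /poisson_term oppr0 cexp0 expr0 fact0 divr1; ring.
pose c := cabs s ^+ N.+1 / N.+1`!%:R.
have := @cderiv_mean_value R (gtail N.+1) (poisson_term N) 0 s (fun t => t ^+ N.+1 * c)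
  (fun t => t ^+ N * (N.+1%:R * c)).
rewrite add0r G0 subr0 expr1n mul1r expr0n mul0r subr0; apply.
- by move=> t _; exact: has_cderiv_gtail.
- move=> t _.
  have dX : is_derive t (1 : R) (fun v : R => v ^+ N.+1) (N.+1%:R * t ^+ N).
    rewrite (_ : (fun v : R => _) = (@id R) ^+ N.+1); last first.
      by apply/funext => v; rewrite exprfctE.
    by apply: (is_derive_eq (is_deriveX N.+1 (is_derive_id t 1))); rewrite /GRing.scale /= mulr1.
  apply: (is_derive_eq (is_deriveM dX (is_derive_cst c t 1))).
  rewrite /GRing.scale /=; ring.
- move=> t /andP[t0 t1]; rewrite add0r Normc.normcM cabs_poisson_term.
  rewrite Normc.normcM cabs_real ger0_norm //.
  have -> : t ^+ N * (N.+1%:R * c) = 1 * ((t * cabs s) ^+ N / N`!%:R) * cabs s.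
    rewrite /c exprS exprMn factS natrM; field.
    by rewrite pnatr_eq0 -lt0n fact_gt0 /= addrC natr1 pnatr_eq0.
  rewrite ler_wpM2r ?cabs_ge0 // ler_wpM2r //.
    by rewrite divr_ge0 // exprn_ge0 // mulr_ge0 ?cabs_ge0.
  rewrite expR_le1 oppr_le0; move: s0; case: (s) => a b /= a0; nra.
Qed.

Lemma expR_ge_term n (x : R) : 0 <= x -> x ^+ n / n`!%:R <= expR x.
Proof.
case: n => [x0|n x0]; first by rewrite expr0 fact0 divr1 -expR0 ler_expR.
by apply: le_trans (expR_ge1Dxn n x0); rewrite lerDr.
Qed.

(** Half of the decay e^(-del |s|) is spent on |s|^i / i! <= (2 / del)^i e^(del |s| / 2); the number
    N of terms is at most 2^N. *)
Lemma cabs_gtail_large (del : R) N s : 0 < del -> del <= 1 -> del * cabs s <= Re s ->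
  cabs (1 - gtail N s) <= (4 / del) ^+ N * expR (- (del / 2 * cabs s)).
Proof.
move=> d0 d1 hs; rewrite /gtail opprB addrC subrK.
apply: le_trans (cabs_sum _ _ _) _.
have x0 := cabs_ge0 s.
have bd (i : nat) : (i < N)%N ->
    cabs (poisson_term i s) <= (2 / del) ^+ N * expR (- (del / 2 * cabs s)).
  move=> iN; rewrite cabs_poisson_term.
  have h : (del / 2 * cabs s) ^+ i / i`!%:R <= expR (del / 2 * cabs s).
    by apply: expR_ge_term; rewrite mulr_ge0 // divr_ge0 // ltW.
  have -> : cabs s ^+ i / i`!%:R = (2 / del) ^+ i * ((del / 2 * cabs s) ^+ i / i`!%:R).
    by rewrite mulrA -exprMn; congr (_ ^+ _ / _); field; rewrite gt_eqF.
  rewrite mulrCA.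
  have h2 : 1 <= 2 / del by rewrite ler_pdivlMr // mul1r; lra.
  have h3 : (2 / del) ^+ i <= (2 / del) ^+ N by apply: ler_weXn2l => //; exact: ltnW.
  have h4 : expR (- Re s) * ((del / 2 * cabs s) ^+ i / i`!%:R) <=
      expR (- (del / 2 * cabs s)).
    apply: (@le_trans _ _ (expR (- Re s) * expR (del / 2 * cabs s))).
      by rewrite ler_wpM2l ?expR_ge0.
    by rewrite -expRD ler_expR; lra.
  apply: ler_pM h3 h4; first by rewrite exprn_ge0 // (le_trans ler01).
  by rewrite mulr_ge0 ?expR_ge0 // divr_ge0 // exprn_ge0 // mulr_ge0 // divr_ge0 // ltW.
apply: (@le_trans _ _ (\sum_(i < N) (2 / del) ^+ N * expR (- (del / 2 * cabs s)))).
  by apply: ler_sum => i _; exact: bd.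
rewrite sumr_const card_ord -[_ *+ N]mulr_natl mulrA ler_wpM2r ?expR_ge0 //.
rewrite (_ : 4 / del = 2 * (2 / del)); last by field; rewrite gt_eqF.
rewrite [(2 * (2 / del)) ^+ N]exprMn ler_wpM2r ?exprn_ge0 ?divr_ge0 ?(ltW d0) //.
by rewrite -natrX ler_nat ltnW // ltn_expl.
Qed.

End GammaKernel.

(** * Derivatives of powers times the kernel *)

Section DerivativeRecursion.
Context {R : realType} (al lam : R).
Local Notation C := R[i].
Implicit Types (z s : C) (g h : nat -> C) (m : R).

(* [cexp ((m - k) z) * dcoef k m N (gtail ^~ (svar z))] is the [k]-th derivative
   with respect to [cexp z] of [cexp (m z) * gtail N (svar z)]. *)
Fixpoint dcoef (k : nat) m (N : nat) g : C :=
  if k is k'.+1 then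
    (m - al * N%:R)%:C * dcoef k' (m - 1) N g +
    (al * N%:R)%:C * dcoef k' (m - 1) N.+1 g
  else g N.

(** The kernel variable s = lam z^(-al), in the logarithmic coordinate. *)
Definition svar z : C := lam%:C * cexp (- al%:C * z).

Lemma dcoefB k m N g h :
  dcoef k m N (fun n => g n - h n) = dcoef k m N g - dcoef k m N h.
Proof. by elim: k m N => [|k IH] m N //=; rewrite !IH; ring. Qed.

Lemma dcoef1_eq k m N N' : dcoef k m N (fun=> 1) = dcoef k m N' (fun=> 1).
Proof.
elim: k m N N' => [|k IH] m N N' //=.
rewrite (IH _ N.+1 N) (IH _ N'.+1 N) (IH _ N' N).
by rewrite -!mulrDl -!rmorphD /= !subrK.
Qed.

(** With the kernel replaced by 1 this is the k-th derivative of z^p; the falling factorial vanishes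
    for k > p. *)
Lemma dcoef1 k p N : dcoef k p%:R N (fun=> 1) = (p ^_ k)%:R.
Proof.
elim: k p N => [|k IH] p N; first by rewrite /= ffactn0.
rewrite /= (dcoef1_eq _ _ N.+1 N) -mulrDl -rmorphD /= subrK.
case: p => [|p]; first by rewrite mul0r ffact0n.
by rewrite -natr1 addrK IH ffactSS natrM natr1 rmorph_nat.
Qed.

(** Each differentiation multiplies by at most |m| + 2 al N and moves m and N by at most 1, so all k
    factors are below the displayed base. *)
Lemma cabs_dcoef k m N g (B : R) : 0 <= al ->
  (forall i, (i <= k)%N -> cabs (g (N + i)%N) <= B) ->
  cabs (dcoef k m N g) <= (`|m| + k%:R + 2 * al * (N + k)%:R) ^+ k * B.
Proof.
move=> al0; elim: k m N => [|k IH] m N hB.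
  by rewrite /= expr0 mul1r; have := hB 0%N (leqnn _); rewrite addn0.
set X := `|m| + k.+1%:R + 2 * al * (N + k.+1)%:R.
have B0 : 0 <= B by apply: le_trans (hB 0%N _); rewrite ?cabs_ge0.
have m1 : `|m - 1| <= `|m| + 1 by apply: le_trans (ler_normB _ _) _; rewrite normr1.
have step N' : (N <= N' <= N.+1)%N ->
    cabs (dcoef k (m - 1) N' g) <= X ^+ k * B.
  move=> /andP[N1 N2].
  apply: le_trans (IH (m - 1) N' _) _ => [i ik|].
    have -> : (N' + i = N + (N' - N + i))%N by rewrite addnA subnKC.
    apply: hB; rewrite -(add1n k) leq_add // leq_subLR addn1 //.
  apply: ler_wpM2r => //; apply: lerXn2r; rewrite ?nnegrE ?addr_ge0 ?mulr_ge0 //.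
  rewrite /X -natr1.
  have : 2 * al * (N' + k)%:R <= 2 * al * (N + k.+1)%:R.
    by rewrite ler_wpM2l ?mulr_ge0 // ler_nat addnS -addSn leq_add2r.
  lra.
have h1 := step N; have h2 := step N.+1.
rewrite leqnn leqnSn /= in h1; rewrite leqnSn leqnn /= in h2.
rewrite /= exprS -mulrA; apply: le_trans (cabsD _ _) _.
rewrite !Normc.normcM !cabs_real.
have X0 : 0 <= X ^+ k * B.
  by rewrite mulr_ge0 // exprn_ge0 // !addr_ge0 ?mulr_ge0.
apply: (@le_trans _ _ ((`|m - al * N%:R| + `|al * N%:R|) * (X ^+ k * B))).
  by rewrite mulrDl; apply: lerD; rewrite ler_wpM2l ?h1 ?h2.
rewrite ler_wpM2r //; apply: le_trans (lerD (ler_normB _ _) (lexx _)) _.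
have aN : 0 <= al * N%:R by exact: mulr_ge0.
have aN' : al * N%:R <= al * (N + k.+1)%:R by rewrite ler_wpM2l // ler_nat leq_addr.
have k0 : 0 <= k.+1%:R :> R by [].
rewrite (ger0_norm aN) /X -mulrA; lra.
Qed.

Lemma has_cderiv_svar z : has_cderiv svar z (- al%:C * svar z).
Proof.
apply: has_cderiv_eq (has_cderivZ _ (has_cderiv_exp (has_cderiv_lin _ _))) _.
by rewrite /svar; ring.
Qed.

(** The identity s P_N = (N + 1) P_(N+1) for Poisson terms turns the derivative into a difference of
    consecutive tails, which closes the family under differentiation. *)
Lemma has_cderiv_gtail_svar N z : has_cderiv (fun w => gtail N (svar w)) z
  ((al * N%:R)%:C * (gtail N.+1 (svar z) - gtail N (svar z))).
Proof.
case: N => [|N].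
  rewrite mulr0 mul0r (_ : (fun w => _) = (fun=> 1)); first exact: has_cderiv_cst.
  by apply/funext => w; rewrite /gtail big_ord0 subr0.
apply: has_cderiv_eq (has_cderiv_comp (has_cderiv_svar z) (has_cderiv_gtail N _)) _.
rewrite [gtail N.+2 _]gtailS addrAC subrr add0r rmorphM /= rmorph_nat.
transitivity (- al%:C * (svar z * poisson_term N (svar z))); first ring.
by rewrite poisson_termS; ring.
Qed.

Definition dterm (k : nat) m (N : nat) z : C :=
  cexp ((m - k%:R)%:C * z) * dcoef k m N (fun n => gtail n (svar z)).

Lemma has_cderiv_dterm k m N z :
  has_cderiv (dterm k m N) z (cexp z * dterm k.+1 m N z).
Proof.
have shift (r : R) w : cexp w * cexp ((r - 1)%:C * w) = cexp (r%:C * w).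
  by rewrite -cexpD; congr cexp; rewrite rmorphB /= rmorph1; ring.
elim: k m N => [|k IH] m N.
  have := has_cderivM (has_cderiv_exp (has_cderiv_lin (m - 0)%:C z))
    (has_cderiv_gtail_svar N z).
  move/has_cderiv_eq; apply; rewrite /dterm /= mulr1n [RHS]mulrA shift subr0.
  by rewrite rmorphB /= ; ring.
have E w : dterm k.+1 m N w = (m - al * N%:R)%:C * dterm k (m - 1) N w +
    (al * N%:R)%:C * dterm k (m - 1) N.+1 w.
  by rewrite /dterm /= -natr1 (_ : m - (k%:R + 1) = m - 1 - k%:R); ring.
rewrite (_ : dterm k.+1 m N = fun w => (m - al * N%:R)%:C * dterm k (m - 1) N w +
    (al * N%:R)%:C * dterm k (m - 1) N.+1 w); last exact/funext.
apply: has_cderiv_eq (has_cderivD (has_cderivZ _ (IH _ _)) (has_cderivZ _ (IH _ _))) _.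
rewrite /dterm [dcoef k.+2 m N _]/= [dcoef k.+1 (m - 1) N _]/= [dcoef k.+1 (m - 1) N.+1 _]/=.
by rewrite -(natr1 k.+1) (_ : m - (k.+1%:R + 1) = m - 1 - k.+1%:R); ring.
Qed.

End DerivativeRecursion.

(** * Bounds for the terms of the sum *)

Section TermBounds.
Context {R : realType}.
Local Notation C := R[i].

Lemma linear_le_exp (al eta : R) : 0 < al -> 0 < eta ->
  exists2 c, 0 <= c & forall v, v <= eta * expR (al * v) + c.
Proof.
move=> al0 eta0; have ea0 : 0 < eta * al by exact: mulr_gt0.
exists (`|ln (eta * al)| / al); first by rewrite divr_ge0 // ltW.
move=> v; have := expR_ge1Dx (ln (eta * al) + al * v).
rewrite expRD lnK ?posrE // => h.
have h2 := ler_norm (- ln (eta * al)); rewrite normrN in h2.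
rewrite -(ler_pM2l al0) mulrDr [al * (_ / _)]mulrCA divff ?gt_eqF // mulr1.
have -> : al * (eta * expR (al * v)) = eta * al * expR (al * v) by ring.
lra.
Qed.

(** As N > b p, the decay |s|^N of order |z|^(-N/b) compensates |z|^p for large |z|. *)
Definition node_order (b : R) (p : nat) : nat := (Num.truncn (b * p%:R)).+1.

Lemma node_order_bounds (b : R) (p : nat) : 0 < b ->
  [/\ p%:R <= b^-1 * (node_order b p)%:R, (node_order b p)%:R <= (b + 1) * p.+1%:R &
      p.+1%:R <= (1 + b^-1) * (node_order b p)%:R].
Proof.
move=> b0; have bp0 : 0 <= b * p%:R by rewrite mulr_ge0 // ltW.
have /andP[h1 h2] := truncn_itv bp0.
have ib0 : 0 < b^-1 by rewrite invr_gt0.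
have N1 : 1 <= (node_order b p)%:R :> R by rewrite ler1n.
have pN : p%:R <= b^-1 * (node_order b p)%:R.
  by rewrite mulrC ler_pdivlMr // mulrC ltW.
split => //.
  rewrite /node_order -!natr1; have : 0 <= p%:R :> R by []. nra.
rewrite -natr1; nra.
Qed.

(** With v = - Re z - xi one has |s| = N e^(al v), so the cut-off is at v = 0. For v > 0 and k > p
    the growth e^(k v) competes with e^(-del |s| / 2); the balance lies near v = b ln
    [node_ratio p k], which explains the logarithmic term. *)
Lemma dterm_bound (b del : R) : 0 < b -> 0 < del -> del <= 1 ->
  exists2 A : R, 0 <= A & forall p k (xi : R) (z : C),
    let N := node_order b p in
    let lam := N%:R * expR (- (b^-1 * xi)) in
    del * cabs (svar b^-1 lam z) <= Re (svar b^-1 lam z) ->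
    cabs (dterm b^-1 lam k p%:R N z) <=
      (p.+1%:R + k%:R) ^+ k * expR (xi * (k%:R - p%:R) + b * k%:R * ln (node_ratio p k)
        + A * (p.+1%:R + k%:R)).
Proof.
move=> b0 d0 d1; set al := b^-1.
have al0 : 0 < al by rewrite invr_gt0.
have alb : al * b = 1 by rewrite mulVf // gt_eqF.
(* This slope fits because k divided by the ratio is at most p + 1, hence at most (1 + al) N. *)
have eta0 : 0 < del / 2 / (1 + al) by rewrite !divr_gt0 // addr_gt0.
have [c c0 hc] := linear_le_exp al0 eta0.
pose q := ln (4 / del); pose c3 := 1 + 2 * al * (b + 1).
have Q4 : 1 <= 4 / del by rewrite ler_pdivlMr // mul1r; lra.
have q0 : 0 <= q by exact: ln_ge0.
have c31 : 1 <= c3 by rewrite lerDl !mulr_ge0 // ?ltW // addr_gt0.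
have l0 : 0 <= ln c3 by exact: ln_ge0.
pose A1 := b + 2 + q * (b + 2) + c.
have A10 : 0 <= A1 by rewrite !addr_ge0 ?mulr_ge0 ?addr_ge0 ?(ltW b0).
exists (ln c3 + A1); first exact: addr_ge0.
move=> p k xi z N lam hs; have [] := node_order_bounds p b0.
rewrite -/N -/al => pN Np Pn.
rewrite -/al in lam hs *; set s := svar al lam z in hs *.
pose PK : R := p.+1%:R + k%:R.
have k0 : 0 <= k%:R :> R by []. have p0 : 0 <= p%:R :> R by [].
have P1 : 1 <= p.+1%:R :> R by rewrite ler1n.
have N0 : 0 <= N%:R :> R by [].
have PK1 : 1 <= PK by rewrite /PK; lra.
have NPK : N%:R <= (b + 1) * PK.
  by apply: le_trans Np _; rewrite ler_wpM2l ?lerDl // addr_ge0 // ltW.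
pose v := - Re z - xi.
have cs : cabs s = N%:R * expR (al * v).
  rewrite /s /svar Normc.normcM cabs_real cabs_cexp ger0_norm; last first.
    by rewrite mulr_ge0 ?expR_ge0.
  rewrite -mulrA -expRD; congr (_ * expR _); rewrite /v; case: (z) => x y /=; ring.
have QN i : (i <= k)%N -> (4 / del) ^+ (N + i) <= expR (q * (b + 2) * PK).
  move=> ik; apply: (@le_trans _ _ ((4 / del) ^+ (N + k))).
    by apply: ler_weXn2l => //; rewrite leq_add2l.
  rewrite -[X in X ^+ _](@lnK R) ?posrE; last exact: lt_le_trans Q4.
  rewrite -expRM_natl ler_expR mulrC -mulrA ler_wpM2l // natrD /PK; nra.
have e2 (x : R) : 1 <= x -> 2 <= expR x.
  by move=> x1; have := expR_ge1Dx x; lra.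
(* [g] will be the tail or its complement to 1, whichever is small in the region considered. *)
suff [g [gE gB]] : exists g : nat -> C,
    cabs (dcoef al k p%:R N (fun n => gtail n s)) = cabs (dcoef al k p%:R N g) /\
    forall i, (i <= k)%N -> cabs (g (N + i)%N) * expR ((k%:R - p%:R) * v) <=
      expR (b * k%:R * ln (node_ratio p k) + A1 * PK).
  rewrite /dterm Normc.normcM cabs_cexp gE.
  have -> : Re ((p%:R - k%:R)%:C * z) = (k%:R - p%:R) * xi + (k%:R - p%:R) * v.
    by rewrite /v; case: (z) => x y /=; ring.
  have swap (r1 r2 D : R) : expR (r1 + r2) * D = expR r1 * (D * expR r2).
    by rewrite expRD; ring.
  rewrite swap.
  pose B := expR (b * k%:R * ln (node_ratio p k) + A1 * PK) / expR ((k%:R - p%:R) * v).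
  have gB' i : (i <= k)%N -> cabs (g (N + i)%N) <= B.
    by move=> ik; rewrite ler_pdivlMr ?expR_gt0 // gB.
  have h := cabs_dcoef p%:R (ltW al0) gB'.
  have h2 : cabs (dcoef al k p%:R N g) * expR ((k%:R - p%:R) * v) <=
      (`|p%:R| + k%:R + 2 * al * (N + k)%:R) ^+ k *
      expR (b * k%:R * ln (node_ratio p k) + A1 * PK).
    by move: h; rewrite /B mulrA ler_pdivlMr ?expR_gt0.
  apply: le_trans (ler_wpM2l (expR_ge0 _) h2) _.
  have h3 : (`|p%:R| + k%:R + 2 * al * (N + k)%:R) ^+ k <= PK ^+ k * expR (ln c3 * PK).
    apply: (@le_trans _ _ ((c3 * PK) ^+ k)).
      apply: lerXn2r; rewrite ?nnegrE ?addr_ge0 ?mulr_ge0 ?(ltW al0) //.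
        by rewrite (le_trans ler01).
        by rewrite (le_trans ler01).
      rewrite ger0_norm // /c3 mulrDl mul1r natrD.
      have : 2 * al * (N%:R + k%:R) <= 2 * al * ((b + 1) * PK).
        rewrite ler_wpM2l ?mulr_ge0 ?(ltW al0) // mulrDl mul1r /PK.
        have : 0 <= b * k%:R by rewrite mulr_ge0 // ltW.
        move: Np; rewrite mulrDl mul1r; lra.
      rewrite mulrA; have : p%:R + k%:R <= PK by rewrite /PK -natr1; lra.
      lra.
    rewrite exprMn mulrC ler_wpM2l ?exprn_ge0 //; first by rewrite (le_trans ler01).
    rewrite -[X in X ^+ _](@lnK R) ?posrE; last exact: lt_le_trans c31.
    rewrite -expRM_natl ler_expR mulrC ler_wpM2l // /PK; lra.
  rewrite mulrCA; apply: le_trans (ler_wpM2r _ h3) _.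
    by rewrite mulr_ge0 ?expR_ge0.
  rewrite -[X in X <= _]mulrA -!expRD ler_wpM2l ?exprn_ge0 //; first by rewrite (le_trans ler01).
  by rewrite ler_expR le_eqVlt; apply/orP; left; apply/eqP; rewrite /PK; ring.
have lnr : 0 <= b * k%:R * ln (node_ratio p k).
  by rewrite !mulr_ge0 ?(ltW b0) // ln_ge0 // node_ratio_ge1.
have s0 : 0 <= Re s by apply: le_trans hs; rewrite mulr_ge0 ?cabs_ge0 ?(ltW d0).
(* v <= 0 means |s| <= N, where the gamma tail is small. *)
have [v0|v0] := leP v 0.
  exists (fun n => gtail n s); split => // i ik.
  have := @cabs_gtail_small R (Num.truncn (b * p%:R) + i)%N s s0.
  rewrite -addSn -/(node_order b p) -/N cs exprMn => h.
  apply: le_trans (ler_wpM2r (expR_ge0 _) h) _.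
  have h2 : N%:R ^+ (N + i) / (N + i)`!%:R <= expR N%:R :> R by exact: expR_ge_term.
  have h3 : expR (al * v) ^+ (N + i) * expR ((k%:R - p%:R) * v) <= 1.
    rewrite -expRM_natl -expRD expR_le1 natrD.
    have ai : 0 <= al * i%:R by rewrite mulr_ge0 // ltW.
    have : 0 <= (al * N%:R + al * i%:R + k%:R - p%:R) * (- v).
      by rewrite mulr_ge0 ?oppr_ge0 //; lra.
    lra.
  have h4 : 2 * (N%:R ^+ (N + i) / (N + i)`!%:R) * 1 <=
      expR (b * k%:R * ln (node_ratio p k) + A1 * PK).
    rewrite mulr1; apply: (@le_trans _ _ (expR PK * expR ((b + 1) * PK))).
      apply: ler_pM; [by []|by rewrite divr_ge0 ?exprn_ge0|exact: e2|].
      by apply: le_trans h2 _; rewrite ler_expR.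
    rewrite -expRD ler_expR /A1.
    have : 0 <= (q * (b + 2) + c) * PK.
      by rewrite mulr_ge0 ?addr_ge0 ?mulr_ge0 ?addr_ge0 ?(ltW b0) // (le_trans ler01).
    lra.
  apply: le_trans h4.
  have -> : 2 * (N%:R ^+ (N + i) * expR (al * v) ^+ (N + i) / (N + i)`!%:R) *
      expR ((k%:R - p%:R) * v) = 2 * (N%:R ^+ (N + i) / (N + i)`!%:R) *
      (expR (al * v) ^+ (N + i) * expR ((k%:R - p%:R) * v)) by ring.
  by rewrite ler_wpM2l // mulr_ge0 // divr_ge0 // exprn_ge0.
have [kp|pk] := leqP k p.
  exists (fun n => gtail n s); split => // i ik.
  have ev : expR ((k%:R - p%:R) * v) <= 1.
    by rewrite expR_le1 mulr_le0_ge0 ?(ltW v0) // subr_le0 ler_nat.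
  have h : cabs (gtail (N + i) s) <= 1 + expR (q * (b + 2) * PK).
    rewrite (_ : gtail (N + i) s = 1 - (1 - gtail (N + i) s)); last by ring.
    apply: le_trans (cabsB _ _) _; rewrite Normc.normc1 lerD2l.
    apply: le_trans (cabs_gtail_large (N + i)%N d0 d1 hs) _.
    rewrite (le_trans _ (QN i ik)) // ler_piMr //.
      by rewrite exprn_ge0 // (le_trans ler01).
    by rewrite expR_le1 oppr_le0 mulr_ge0 ?cabs_ge0 // divr_ge0 // ltW.
  apply: (@le_trans _ _ ((1 + expR (q * (b + 2) * PK)) * 1)).
    by apply: ler_pM; rewrite ?cabs_ge0 ?expR_ge0.
  have qq : 0 <= q * (b + 2) * PK.
    by apply: mulr_ge0; [apply: mulr_ge0 => //; lra|lra].
  have x1 : 1 <= expR (q * (b + 2) * PK).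
    by have := expR_ge1Dx (q * (b + 2) * PK); lra.
  apply: (@le_trans _ _ (expR PK * expR (q * (b + 2) * PK))).
    have := e2 _ PK1; nra.
  rewrite -expRD ler_expR /A1.
  have : 0 <= (b + 1 + c) * PK.
    by apply: mulr_ge0; lra.
  lra.
(* The k-th derivative kills z^p, so that [gtail] may be replaced by [1 - gtail]. *)
exists (fun n => 1 - gtail n s); split.
  by rewrite [in RHS]dcoefB [in RHS]dcoef1 ffact_small // sub0r cabsN.
move=> i ik; have hL := cabs_gtail_large (N + i)%N d0 d1 hs.
apply: le_trans (ler_wpM2r (expR_ge0 ((k%:R - p%:R) * v)) hL) _.
rewrite -[X in X <= _]mulrA; apply: le_trans (ler_wpM2r _ (QN i ik)) _.
  by rewrite mulr_ge0 ?expR_ge0.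
rewrite -!expRD ler_expR cs.
have La1 := node_ratio_ge1 (R := R) p k.
have La0 : 0 < node_ratio p k :> R by exact: lt_le_trans La1.
have kLa : k%:R <= node_ratio p k * p.+1%:R :> R.
  by rewrite -ler_pdivrMr ?ltr0n // le_max lexx orbT.
(* Translating v by b ln of the ratio divides e^(al v) by the ratio, as al b = 1. *)
have h1 : k%:R * v <= b * k%:R * ln (node_ratio p k) +
    k%:R * (del / 2 / (1 + al) * (expR (al * v) / node_ratio p k) + c).
  have := hc (v - b * ln (node_ratio p k)).
  have -> : al * (v - b * ln (node_ratio p k)) = al * v - ln (node_ratio p k).
    by rewrite mulrBr mulrA alb mul1r.
  rewrite expRD expRN lnK ?posrE // => /(ler_wpM2l k0).
  by rewrite mulrBr; lra.
have h2 : k%:R * (del / 2 / (1 + al) * (expR (al * v) / node_ratio p k)) <=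
    del / 2 * (N%:R * expR (al * v)).
  have a1 : 0 < 1 + al by rewrite addr_gt0.
  have -> : k%:R * (del / 2 / (1 + al) * (expR (al * v) / node_ratio p k)) =
      del / 2 * (k%:R / node_ratio p k / (1 + al) * expR (al * v)).
    by field; rewrite !gt_eqF.
  rewrite ler_wpM2l ?divr_ge0 ?(ltW d0) // ler_wpM2r ?expR_ge0 //.
  rewrite ler_pdivrMr // ler_pdivrMr //.
  by apply: le_trans kLa _; rewrite mulrC ler_pM2r // mulrC.
have h3 : (k%:R - p%:R) * v <= k%:R * v.
  by rewrite ler_wpM2r ?(ltW v0) // lerBlDr lerDl.
have h4 : k%:R * c <= c * PK by rewrite mulrC ler_wpM2l // /PK; lra.
have h5 : 0 <= (b + 2) * PK.
  by apply: mulr_ge0; lra.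
clearbody v; rewrite mulrDr in h1; rewrite /A1; lra.
Qed.

End TermBounds.

(** * Terms of the Borel-Ritt sum *)

Section BorelTerms.
Context {R : realType}.
Local Notation C := R[i].

(** The argument of s is - al Im z, of absolute value below al gamma pi / 2, and cosine decreases on
    [0, pi]. *)
Lemma svar_sector (al lam gamma : R) (z : C) : 0 <= lam -> 0 < al -> 0 < gamma ->
  al * gamma < 1 -> `|Im z| < gamma * pi / 2 ->
  cos (al * (gamma * pi / 2)) * cabs (svar al lam z) <= Re (svar al lam z).
Proof.
move=> lam0 al0 ga0 ag hz.
have pi0 := pi_gt0 R.
rewrite /svar Normc.normcM cabs_real cabs_cexp ger0_norm //.
have -> : Re (lam%:C * cexp (- al%:C * z)) =
    lam * (expR (Re (- al%:C * z)) * cos (al * Im z)).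
  rewrite /cexp; case: z hz => x y _ /=.
  have -> : - al * y + - 0 * x = - (al * y) by ring.
  by rewrite cosN; ring.
rewrite mulrCA ler_wpM2l // mulrC ler_wpM2l ?expR_ge0 //.
have -> : cos (al * Im z) = cos `|al * Im z|.
  by have [h|h] := ger0P (al * Im z); rewrite ?cosN.
have yle : `|al * Im z| <= al * (gamma * pi / 2).
  by rewrite normrM gtr0_norm // ler_pM2l // ltW.
have hp : al * (gamma * pi / 2) <= pi.
  have : al * gamma * pi <= 1 * pi by rewrite ler_pM2r // ltW.
  have -> : al * (gamma * pi / 2) = al * gamma * pi / 2 by ring.
  lra.
move: yle; rewrite le_eqVlt => /orP[/eqP-> //|lty]; apply: ltW.
rewrite ltr_cos // in_itv /= ?normr_ge0 ?hp ?andbT /=.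
  by rewrite (le_trans (ltW lty)).
by rewrite (le_trans _ (ltW lty)).
Qed.

Lemma cos_aperture (al gamma : R) : 0 < al -> 0 < gamma -> al * gamma < 1 ->
  0 < cos (al * (gamma * pi / 2)) <= 1.
Proof.
move=> al0 ga0 ag; rewrite cos_le1 andbT; apply: cos_gt0_pihalf.
have pi0 := pi_gt0 R.
have : 0 < al * gamma * pi by rewrite !mulr_gt0.
have : al * gamma * pi < 1 * pi by rewrite ltr_pM2r.
have -> : al * (gamma * pi / 2) = al * gamma * pi / 2 by ring.
lra.
Qed.

Variable b : R.
Implicit Types (a : nat -> C) (y : nat -> R).

(** This is lam_p = N_p x_p^(-al) for x_p = e^(y p) / (p + 1). *)
Definition node_scale y (p : nat) : R :=
  (node_order b p)%:R * expR (- (b^-1 * (y p - ln p.+1%:R))).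

Definition borel_term a y (p k : nat) (z : C) : C :=
  a p / p`!%:R * dterm b^-1 (node_scale y p) k p%:R (node_order b p) z.

Lemma node_scale_gt0 y p : 0 < node_scale y p.
Proof. by rewrite mulr_gt0 ?expR_gt0 // ltr0n. Qed.

Lemma has_cderiv_borel_term a y p k z :
  has_cderiv (borel_term a y p k) z (cexp z * borel_term a y p k.+1 z).
Proof.
apply: has_cderiv_eq (has_cderivZ _ (has_cderiv_dterm _ _ _ _ _ _)) _.
by rewrite /borel_term; ring.
Qed.

(** Both p + 1 and k are at most (p + 1) times the ratio. The powers (p + 1)^k cancel, and (p + 1)^p
    / p! <= e^(p + 1) remains. *)
Lemma factorial_node_bound (p k : nat) :
  (p.+1%:R + k%:R) ^+ k / p`!%:R * expR (- (ln p.+1%:R * (k%:R - p%:R))) <=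
  expR (k%:R * ln (node_ratio p k) + k%:R + p.+1%:R) :> R.
Proof.
have P0 : 0 < p.+1%:R :> R by rewrite ltr0n.
have La0 : 0 < node_ratio p k :> R by apply: lt_le_trans (node_ratio_ge1 p k).
have f0 : 0 < p`!%:R :> R by rewrite ltr0n fact_gt0.
have e1 : 2 <= expR 1 :> R by have := expR_ge1Dx (1 : R); lra.
have h1 : p.+1%:R + k%:R <= expR (1 + ln (node_ratio p k) + ln p.+1%:R) :> R.
  rewrite !expRD !lnK ?posrE //.
  apply: (@le_trans _ _ (2 * node_ratio p k * p.+1%:R)); last first.
    by rewrite ler_pM2r // ler_pM2r.
  have := node_ratio_ge1 (R := R) p k.
  have : k%:R <= node_ratio p k * p.+1%:R :> R.
    by rewrite -ler_pdivrMr // le_max lexx orbT.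
  have : 0 < p.+1%:R :> R by []. nra.
have h2 : (p.+1%:R + k%:R) ^+ k <=
    expR (k%:R * (1 + ln (node_ratio p k) + ln p.+1%:R)) :> R.
  rewrite expRM_natl; apply: lerXn2r => //; rewrite nnegrE ?expR_ge0 ?addr_ge0 //.
have h3 : expR (p%:R * ln p.+1%:R) / p`!%:R <= expR p.+1%:R :> R.
  rewrite expRM_natl lnK ?posrE //; apply: expR_ge_term; exact: ltW.
apply: (@le_trans _ _ (expR (k%:R * (1 + ln (node_ratio p k) + ln p.+1%:R)) / p`!%:R *
    expR (- (ln p.+1%:R * (k%:R - p%:R))))).
  by rewrite ler_pM2r ?expR_gt0 // ler_pM2r ?invr_gt0.
apply: (@le_trans _ _ (expR (k%:R * ln (node_ratio p k) + k%:R) *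
    (expR (p%:R * ln p.+1%:R) / p`!%:R))); last first.
  by rewrite [X in _ <= X]expRD ler_pM2l ?expR_gt0.
rewrite mulrAC -expRD mulrA -expRD ler_pM2r ?invr_gt0 //.
by rewrite ler_expR le_eqVlt; apply/orP; left; apply/eqP; ring.
Qed.

Lemma borel_term_bound (del : R) : 0 < b -> 0 < del -> del <= 1 ->
  exists2 A : R, 0 <= A & forall a y p k (z : C),
    del * cabs (svar b^-1 (node_scale y p) z) <= Re (svar b^-1 (node_scale y p) z) ->
    cabs (borel_term a y p k z) <= expR A * (cabs (a p) *
      expR (y p * (k%:R - p%:R) + (1 + b) * k%:R * ln (node_ratio p k)
        + A * (p%:R + k%:R))).
Proof.
move=> b0 d0 d1; have [A A0 hA] := dterm_bound b0 d0 d1.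
exists (A + 1) => [|a y p k z hs]; first lra.
rewrite /borel_term Normc.normcM [cabs (_ / _)]Normc.normcM Normc.normcV cabs_nat.
have h : cabs (dterm b^-1 (node_scale y p) k p%:R (node_order b p) z) <= _ :=
  hA p k (y p - ln p.+1%:R) z hs.
have f0 : 0 < p`!%:R :> R by rewrite ltr0n fact_gt0.
rewrite -[X in X <= _]mulrA [X in _ <= X]mulrCA ler_wpM2l ?cabs_ge0 //.
apply: le_trans (ler_wpM2l _ h) _; first by rewrite invr_ge0 ltW.
pose E := expR (y p * (k%:R - p%:R) + b * k%:R * ln (node_ratio p k) + A * (p.+1%:R + k%:R)).
apply: (@le_trans _ _ ((p.+1%:R + k%:R) ^+ k / p`!%:R *
    expR (- (ln p.+1%:R * (k%:R - p%:R))) * E)).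
  rewrite -[X in _ <= X]mulrA /E -expRD [X in X <= _]mulrA (mulrC _^-1) le_eqVlt.
  by apply/orP; left; apply/eqP; congr (_ * expR _); ring.
apply: le_trans (ler_wpM2r (expR_ge0 _) (factorial_node_bound p k)) _.
rewrite -!expRD ler_expR -natr1 le_eqVlt; apply/orP; left; apply/eqP; ring.
Qed.

(** Split the tail as 1 minus its complement. The part from 1 is the k-th derivative of a monomial:
    a_k if p = k, zero if p < k, and O(|z|) if p > k. The complement is flat at the vertex. *)
Lemma borel_term_vertex (del : R) a y p k : 0 < b -> 0 < del -> del <= 1 ->
  exists M : R, forall z : C,
    del * cabs (svar b^-1 (node_scale y p) z) <= Re (svar b^-1 (node_scale y p) z) ->
    Re z <= 0 ->
    cabs (borel_term a y p k z - (if p == k then a k else 0)) <= M * expR (Re z).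
Proof.
move=> b0 d0 d1.
set al := b^-1; set N := node_order b p; set lam := node_scale y p.
have al0 : 0 < al by rewrite invr_gt0.
have lam0 : 0 < lam by exact: node_scale_gt0.
have k10 : 0 < k%:R + 1 :> R by rewrite ltr_wpDl.
(* Scaled so that flatness beats |z|^(-k) with one power of |z| to spare. *)
have eta0 : 0 < del / 2 * lam / (k%:R + 1) by rewrite !divr_gt0 // mulr_gt0 // divr_gt0.
have [c c0 hc] := linear_le_exp al0 eta0.
pose W := (`|p%:R : R| + k%:R + 2 * al * (N + k)%:R) ^+ k.
pose D := (4 / del) ^+ (N + k) * expR ((k%:R + 1) * c).
pose ap := cabs (a p / p`!%:R).
exists (ap * ((p ^_ k)%:R + W * D)) => z hs z0.
have Q4 : 1 <= 4 / del by rewrite ler_pdivlMr // mul1r; lra.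
have fact0 : (p`!%:R : C) != 0 by exact: factC_neq0.
set s := svar al lam z in hs *.
have Ez : expR (Re ((p%:R - k%:R)%:C * z)) = expR ((p%:R - k%:R) * Re z).
  by congr expR; case: (z) => ? ? /=; ring.
pose g n : C := 1 - gtail n s.
have gE : dcoef al k p%:R N (fun n => gtail n s) =
    (p ^_ k)%:R - dcoef al k p%:R N g.
  rewrite -(dcoef1 al k p N) -[RHS]dcoefB; congr dcoef; apply/funext => n; rewrite /g; ring.
have W0 : 0 <= W by rewrite exprn_ge0 // !addr_ge0 ?mulr_ge0 ?(ltW al0).
have hg : expR ((p%:R - k%:R) * Re z) * cabs (dcoef al k p%:R N g) <= W * D * expR (Re z).
  have hB i : (i <= k)%N -> cabs (g (N + i)%N) <=
      (4 / del) ^+ (N + k) * expR (- (del / 2 * cabs s)).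
    move=> ik; apply: le_trans (cabs_gtail_large (N + i)%N d0 d1 hs) _.
    rewrite ler_wpM2r ?expR_ge0 //; apply: ler_weXn2l => //; by rewrite leq_add2l.
  have h := cabs_dcoef p%:R (ltW al0) hB.
  apply: le_trans (ler_wpM2l (expR_ge0 _) h) _.
  rewrite -/W mulrCA -[X in _ <= X]mulrA ler_wpM2l // mulrCA /D.
  rewrite -[X in _ <= X]mulrA ler_wpM2l ?exprn_ge0 //; first by rewrite (le_trans ler01).
  rewrite -!expRD ler_expR.
  have cs : cabs s = lam * expR (al * (- Re z)).
    rewrite /s /svar Normc.normcM cabs_real cabs_cexp gtr0_norm //.
    by congr (_ * expR _); case: (z) => ? ? /=; ring.
  have := hc (- Re z) => /(ler_wpM2l (ltW k10)).
  have -> : (k%:R + 1) * (del / 2 * lam / (k%:R + 1) * expR (al * - Re z) + c) =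
      del / 2 * cabs s + (k%:R + 1) * c.
    by rewrite cs; field; rewrite gt_eqF.
  have : 0 <= p%:R * - Re z by rewrite mulr_ge0 // oppr_ge0.
  lra.
have main : cabs (cexp ((p%:R - k%:R)%:C * z) * (p ^_ k)%:R - (if p == k then p`!%:R else 0))
    <= (p ^_ k)%:R * expR (Re z).
  have [->|pk] := eqVneq p k.
    rewrite ffactnn subrr mul0r cexp0 mul1r subrr Normc.normc0.
    by rewrite mulr_ge0 ?expR_ge0.
  rewrite subr0 Normc.normcM cabs_cexp cabs_nat mulrC.
  have [kp|pk'] := ltnP k p; last first.
    by rewrite ffact_small ?mul0r // ltn_neqAle pk.
  rewrite ler_wpM2l // Ez ler_expR.
  have : 1 <= p%:R - k%:R :> R by rewrite lerBrDr addrC natr1 ler_nat.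
  nra.
have -> : borel_term a y p k z - (if p == k then a k else 0) = a p / p`!%:R *
   ((cexp ((p%:R - k%:R)%:C * z) * (p ^_ k)%:R - (if p == k then p`!%:R else 0)) -
    cexp ((p%:R - k%:R)%:C * z) * dcoef al k p%:R N g).
  rewrite /borel_term /dterm -/al -/N -/lam gE.
  by have [->|_] := eqVneq p k; field.
rewrite Normc.normcM -/ap -mulrA ler_wpM2l ?cabs_ge0 //.
apply: le_trans (cabsB _ _) _; rewrite mulrDl lerD //.
by rewrite Normc.normcM cabs_cexp Ez.
Qed.

End BorelTerms.

(** * Surjectivity *)

Section BorelMap.
Context {R : realType}.
Local Notation C := R[i].

Lemma vertex_proper (gamma : R) : 0 < gamma -> ProperFilter (vertex (sector gamma)).
Proof.
move=> g0; apply: filter_from_proper.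
  apply: filter_from_filter; first by exists 1 => /=.
  move=> e1 e2 /= e10 e20; exists (Num.min e1 e2); first by rewrite /= lt_min e10.
  by move=> z /= [Sz]; rewrite lt_min => /andP[].
move=> e /= e0; exists (e / 2, 0); split; last by rewrite /modulus /=; lra.
split; first by rewrite /log_surface /modulus /=; lra.
by rewrite /argument /= normr0 divr_gt0 // mulr_gt0 // pi_gt0.
Qed.

Lemma intermediate_index (omega : R -> R) (gamma : R) :
  (gamma%:E < growth_index omega - 1)%E ->
  exists2 b, gamma < b & ((1 + b)%:E < growth_index omega)%E.
Proof.
case: (growth_index omega) => [r| |] //=.
  rewrite lte_fin => h; exists ((gamma + (r - 1)) / 2); rewrite ?lte_fin; lra.
by move=> _; exists (gamma + 1); rewrite ?ltry // ltrDl.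
Qed.

(** On a disc of radius at most 1 inside the strip the factor e^w is bounded, so the first two
    derivatives in w inherit geometric bounds from the shifted families. *)
Lemma has_cderiv_csum_shift (F_ : nat -> nat -> C -> C) (gamma : R) (K_ : nat -> R) :
  (forall k, 0 <= K_ k) ->
  (forall p k z, has_cderiv (F_ p k) z (cexp z * F_ p k.+1 z)) ->
  (forall k z, `|Im z| < gamma -> geometric_le (K_ k) (fun p => F_ p k z)) ->
  forall k z, `|Im z| < gamma ->
  has_cderiv (fun w => csum (fun p => F_ p k w)) z (cexp z * csum (fun p => F_ p k.+1 z)).
Proof.
move=> K0 hF hK k z hz.
have e0 : 0 < Num.min 1 (gamma - `|Im z|) by rewrite lt_min ltr01 subr_gt0.
pose E := expR (Re z + 1); have E0 : 0 <= E by exact: expR_ge0.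
have near w : cabs (w - z) < Num.min 1 (gamma - `|Im z|) ->
    `|Im w| < gamma /\ cabs (cexp w) <= E.
  rewrite lt_min => /andP[h1 h2]; split.
    rewrite (_ : Im w = Im z + Im (w - z)); last by rewrite ImB; ring.
    apply: le_lt_trans (ler_normD _ _) _; have := normr_Im_le (w - z); lra.
  rewrite cabs_cexp ler_expR; have := normr_Re_le (w - z); rewrite ReB.
  have := ler_norm (Re w - Re z); lra.
rewrite -(csumZ _ (hK k.+1 z hz)).
pose K := K_ k + E * K_ k.+1 + E * (E * K_ k.+2).
have q0 p : 0 <= 2^-1 ^+ p :> R by rewrite exprn_ge0.
have b0 : 0 <= E * K_ k.+1 by rewrite mulr_ge0.
have b1 : 0 <= E * (E * K_ k.+2) by rewrite !mulr_ge0.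
have le2 p (x c : R) : x <= c * 2^-1 ^+ p -> c <= K -> x <= K * 2^-1 ^+ p.
  by move=> h cK; apply: le_trans h _; rewrite ler_wpM2r.
have bE w k' p : cabs (w - z) < Num.min 1 (gamma - `|Im z|) ->
    cabs (cexp w * F_ p k' w) <= E * K_ k' * 2^-1 ^+ p.
  move=> /near[hw hE]; rewrite Normc.normcM -mulrA.
  apply: ler_pM; rewrite ?cabs_ge0 //; exact: hK.
apply: (@has_cderiv_csum _ (fun p => F_ p k) (fun p w => cexp w * F_ p k.+1 w)
  (fun p w => cexp w * F_ p k.+1 w + cexp w * (cexp w * F_ p k.+2 w)) z K _ e0).
- by move=> p w _; exact: hF.
- move=> p w _; apply: has_cderivM; last exact: hF.
  have := has_cderiv_exp (has_cderiv_lin 1 w).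
  rewrite mul1r mulr1 (_ : (fun v => cexp (1 * v)) = cexp) //.
  by apply/funext => v; rewrite mul1r.
- move=> w /near[hw _] p; apply: (le2 _ _ (K_ k)); first exact: hK.
  by rewrite /K; have := K0 k; lra.
- move=> w hw p; apply: (le2 _ _ (E * K_ k.+1)); first exact: bE.
  by rewrite /K; have := K0 k; lra.
- move=> w hw p; apply: (le2 _ _ (E * K_ k.+1 + E * (E * K_ k.+2))); last first.
    by rewrite /K; have := K0 k; lra.
  apply: le_trans (cabsD _ _) _; rewrite mulrDl; apply: lerD; first exact: bE.
  rewrite Normc.normcM -mulrA; apply: ler_pM; rewrite ?cabs_ge0 //; last exact: bE.
  by have [] := near w hw.
Qed.

(** Dominated convergence for series: terms p >= n are small by domination, the finitely many others
    by closeness to the vertex. Of the rate 4^(-p), one factor 2^(-p) gives smallness and the other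
    summability. *)
Lemma tannery_vertex (F_ : nat -> C -> C) (c_ : nat -> C) (gamma K : R) : 0 < K ->
  (forall p z, `|Im z| < gamma -> cabs (F_ p z - c_ p) <= K * 4^-1 ^+ p) ->
  (forall p, exists M : R, forall z, `|Im z| < gamma -> Re z <= 0 ->
     cabs (F_ p z - c_ p) <= M * expR (Re z)) ->
  forall eps, 0 < eps -> exists2 r, 0 < r & forall z, `|Im z| < gamma ->
    expR (Re z) < r -> cabs (csum (fun p => F_ p z - c_ p)) < eps.
Proof.
move=> K0 hK hM eps eps0.
have [M_ hM_] := choice hM.
pose n := (Num.truncn (4 * K / eps)).+1.
have n2 : 4 * (K * 2^-1 ^+ n) < eps.
  have h : 4 * K / eps < 2 ^+ n.
    apply: lt_le_trans (truncnS_gt _) _; rewrite -/n -natrX ler_nat.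
    exact/ltnW/ltn_expl.
  rewrite ltr_pdivrMr // in h.
  by rewrite mulrA exprVn ltr_pdivrMr ?exprn_gt0 // [X in _ < X]mulrC.
have q0 (p : nat) : 0 < 2^-1 ^+ p :> R by rewrite exprn_gt0.
have q1 (p p' : nat) : (p <= p')%N -> 2^-1 ^+ p' <= 2^-1 ^+ p :> R.
  by move=> pp; apply: ler_wiXn2l => //; lra.
pose S := 1 + \sum_(p < n) `|M_ p|.
have S0 : 0 < S by rewrite ltr_pwDl // sumr_ge0.
exists (Num.min 1 (K * 2^-1 ^+ n * 2^-1 ^+ n / S)).
  by rewrite lt_min ltr01 divr_gt0 // !mulr_gt0.
move=> z hz; rewrite lt_min => /andP[z1 z2].
have Rez : Re z <= 0 by rewrite -expR_le1 ltW.
apply: le_lt_trans n2; apply: cabs_csum_le => p.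
have [np|pn] := leqP n p.
  apply: le_trans (hK p z hz) _; rewrite -mulrA ler_pM2l //.
  rewrite (_ : 4^-1 = 2^-1 * 2^-1); last by field.
  by rewrite exprMn ler_pM2r ?q1.
apply: le_trans (hM_ p z hz Rez) _.
have MS : M_ p <= S.
  rewrite /S (bigD1 (Ordinal pn)) //= ; have := ler_norm (M_ p).
  have : 0 <= \sum_(i < n | i != Ordinal pn) `|M_ i| by exact: sumr_ge0.
  lra.
apply: (@le_trans _ _ (S * expR (Re z))); first by rewrite ler_wpM2r ?expR_ge0.
rewrite mulrC -ler_pdivlMr //; apply: le_trans (ltW z2) _.
rewrite ler_pM2r ?invr_gt0 // ler_pM2l ?mulr_gt0 //.
exact/q1/ltnW.
Qed.

End BorelMap.

Theorem theorem7p2 (R : realType) (omega : R -> R) (homega : W0 omega)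
    (hindex : (1 < growth_index omega)%E)
    (gamma : R) (gamma_gt0 : (0 < gamma)%R)
    (gamma_lt : (gamma%:E < growth_index omega - 1)%E) :
  set_surj (ultraholomorphic_Beurling omega (sector gamma))
           (Lambda_Beurling omega) (Borel (sector gamma)).
Proof.
move: gamma_gt0 => g0 a ha; have [b gb hb] := intermediate_index gamma_lt.
have b0 : 0 < b by exact: lt_trans gb.
have al0 : 0 < b^-1 by rewrite invr_gt0.
have ag : b^-1 * gamma < 1 by rewrite mulrC ltr_pdivrMr // mul1r.
have /andP[del0 del1] := cos_aperture al0 g0 ag.
set del := cos _ in del0 del1.
have [A A0 hA] := borel_term_bound b0 del0 del1.
have [y hy] := node_selection homega b0 A0 hb ha.
pose strip := gamma * pi / 2.
have hs p z : `|Im z| < strip -> del * cabs (svar b^-1 (node_scale b y p) z) <=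
    Re (svar b^-1 (node_scale b y p) z).
  by move=> hz; apply: svar_sector => //; apply/ltW/node_scale_gt0.
(* The nodes [y] were fixed before l, so one function serves all Beurling bounds. *)
have bound l : 0 < l -> exists2 K, 0 < K & forall p k z, `|Im z| < strip ->
    cabs (borel_term b a y p k z) <= K * weight_seq omega l k * 4^-1 ^+ p.
  move=> l0; have [K K0 hK] := hy l l0.
  exists (expR A * K) => [|p k z hz]; first by rewrite mulr_gt0 ?expR_gt0.
  apply: le_trans (hA a y p k z (hs p z hz)) _.
  apply: le_trans (ler_wpM2l (expR_ge0 A) (hK p k)) _.
  by rewrite le_eqVlt; apply/orP; left; apply/eqP; ring.
have W0' l k : 0 < weight_seq omega l k by exact: expR_gt0.
have geo l : 0 < l -> exists2 K, 0 < K & forall k z, `|Im z| < strip ->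
    geometric_le (K * weight_seq omega l k) (fun p => borel_term b a y p k z).
  move=> l0; have [K K0 hK] := bound l l0; exists K => // k z hz p.
  apply: le_trans (hK p k z hz) _; rewrite ler_pM2l ?mulr_gt0 //.
  by apply: lerXn2r; rewrite ?nnegrE ?invr_ge0 // lef_pV2 ?posrE // ler_nat.
pose F k z := csum (fun p => borel_term b a y p k z).
(* Any one value of l suffices for convergence and differentiation of the series. *)
have [K1 K10 geo1] := geo 1 ltr01.
have stripS z : sector gamma z -> `|Im (logc z)| < strip by case.
have dF k z : sector gamma z -> has_cderiv (F k) (logc z) (cexp (logc z) * F k.+1 (logc z)).
  move=> /stripS hz.
  apply: (@has_cderiv_csum_shift _ (borel_term b a y) strip
    (fun k => K1 * weight_seq omega 1 k)) => //.
    by move=> k'; rewrite mulr_ge0 ?ltW.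
  by move=> p k' w; exact: has_cderiv_borel_term.
pose f (z : R * R) := F 0%N (logc z).
have fk := cderiven_logc dF (fun z _ => erefl (f z)).
exists f.
  move=> l /= l0; split; first exact: (holomorphic_logc (dF 0%N)).
  have [K K0 hK] := geo l l0.
  exists (4 * K) => _ [z Sz [k _ <-]].
  rewrite ler_pdivrMr // fk // -mulrA; apply: cabs_csum_le.
  exact/hK/stripS.
apply/funext => k; have P := vertex_proper g0.
apply: cvg_lim; first exact: norm_hausdorff.
apply/cvgrPdist_lt => eps eps0.
have [e E] : exists e : R, eps = e%:C.
  by exists (Re eps); rewrite RRe_real // gtr0_real.
rewrite {}E ltcR in eps0 *.
pose c p : R[i] := if p == k then a k else 0.
have [K K0 hK] := bound 1 ltr01.
(* The factor 4^k fits the single nonzero entry of [c] under a multiple of 4^(-p). *)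
have K'0 : 0 < K * weight_seq omega 1 k + cabs (a k) * 4 ^+ k.
  by rewrite ltr_pwDl ?mulr_gt0 // mulr_ge0 ?cabs_ge0 // exprn_ge0.
have hc p : cabs (c p) <= cabs (a k) * 4 ^+ k * 4^-1 ^+ p.
  rewrite /c; case: eqP => [->|_]; last first.
    by rewrite Normc.normc0 !mulr_ge0 ?cabs_ge0 // exprn_ge0.
  by rewrite -mulrA -exprMn divff ?expr1n ?mulr1.
have [r r0 hr] := @tannery_vertex _ (fun p => borel_term b a y p k) c strip _ K'0
  (fun p z hz => le_trans (cabsB _ _) (le_trans (lerD (hK p k z hz) (hc p))
     (eq_ind _ (fun x => x <= _) (lexx _) _ (mulrDl _ _ _))))
  (fun p => let: ex_intro M hM := borel_term_vertex a y p k b0 del0 del1 in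
    ex_intro _ M (fun z hz => hM z (hs p z hz))) e eps0.
exists r => // z [Sz zr].
have z0 : 0 < z.1 by case: Sz.
rewrite /= fk // normr_cabs ltcR -cabsN opprB.
rewrite -[a k](csum_single k) -/c.
have hz := stripS z Sz.
have gc : geometric_le (cabs (a k) * 4 ^+ k) c.
  move=> p; apply: le_trans (hc p) _.
  rewrite ler_wpM2l ?mulr_ge0 ?cabs_ge0 ?exprn_ge0 //.
  by apply: lerXn2r; rewrite ?nnegrE ?invr_ge0 // lef_pV2 ?posrE // ler_nat.
rewrite /F -(csumB (geo1 k _ hz) gc); apply: hr => //.
by rewrite /logc /= lnK.
Qed.
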